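(* Suppose that every $P\in\mathcal{P}$ has a quadratic presentation, i.e. a presentation of the form $R^a\to R^a\to P\to0$. Let $\Omega$ be the commutative monoid of finitely generated $\mathcal{I}(R)$-submodules of $\overline{S}^{-1}\mathcal{I}(R)$. Then the map $\mathcal{F}:\mathcal{M}\to\Omega$ defined by $\mathcal{F}(M)=\mathrm{Fitt}^{\max}_R(M)$ is a Fitting invariant.
   Context: Let $\Lambda$ be a commutative noetherian complete local domain with fraction field $Q(\Lambda)$, $A$ a separable $Q(\Lambda)$-algebra, and $R$ a $\Lambda$-order in $A$. Let $S\subset\Lambda\setminus\{0\}$ be an Ore set (i.e. a multiplicative subset containing $1$), necessarily central in $R$. $\mathcal M$ is the category of finitely generated $S$-torsion left $R$-modules and $\mathcal P=\{P\in\mathcal M\mid\mathrm{pd}_R(P)\le1\}$. $Z(-)$ denotes the center and $\mathrm{Nrd}:M_a(A)\to Z(M_a(A))=Z(A)$ the reduced norm. $\mathcal I(R)$ is the $Z(R)$-submodule of $Z(A)$ generated by all $\mathrm{Nrd}(H)$ with $H\in M_a(R)$, $a\ge1$; it is a subring of $Z(A)$ containing $Z(R)$. $\overline S$ is the image of $S$ under $\mathrm{Nrd}:R\to\mathcal I(R)$, a multiplicative subset consisting of non-zero-divisors. For a presentation $R^b\xrightarrow{h}R^a\to M\to0$ of a finitely generated left $R$-module $M$, $\mathrm{Fitt}_R(h)$ is the ideal of $\mathcal I(R)$ generated by $\mathrm{Nrd}(H)$ for all $a\times a$ submatrices $H$ of $h$ (obtained by selecting $a$ of the $b$ standard basis vectors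 of $R^b$). $\mathrm{Fitt}^{\max}_R(M)$ is the unique maximal one among the ideals $\mathrm{Fitt}_R(h)$ over all finite presentations $h$ of $M$. It is known that if $P$ admits a quadratic presentation $h$ then $\mathrm{Fitt}^{\max}_R(P)=\mathrm{Fitt}_R(h)$. A Fitting invariant is a map $\mathcal F$ assigning to each object of $\mathcal M$ an element of a commutative monoid $\Omega$ such that: (i) $\mathcal F(P)\in\Omega^\times$ for $P\in\mathcal P$; (ii) if $0\to M'\to M\to P\to0$ is exact in $\mathcal M$ with $P\in\mathcal P$, then $\mathcal F(M)=\mathcal F(P)\mathcal F(M')$. *)

(* Defs.v *)
From HB Require Import structures.
From mathcomp Require Import all_boot all_order all_algebra all_field.
From mathcomp Require Import boolp classical_sets.

Set Implicit Arguments.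
Unset Strict Implicit.
Unset Printing Implicit Defensive.

Import GRing.Theory.
Local Open Scope ring_scope.
Local Open Scope classical_set_scope.

(* Additive submodules of a ring T over a set C of coefficients in T.
   In every use C is a commutative subring of T containing 1.        *)

Definition submodule (T : nzRingType) (C X : set T) : Prop :=
  [/\ X 0,
      forall x y, X x -> X y -> X (x + y) &
      forall c x, C c -> X x -> X (c * x)].

Definition span (T : nzRingType) (C G : set T) : set T :=
  smallest (submodule C) G.

Definition fin_gen (T : nzRingType) (C X : set T) : Prop :=
  exists (n : nat) (x : 'I_n -> T), X = span C (range x).

Definition submodule_mul (T : nzRingType) (C X Y : set T) : set T :=
  span C [set z | exists x y, [/\ X x, Y y & z = x * y]].

Definition ideal (L : comNzRingType) : set L -> Prop := submodule setT.

Fixpoint ideal_pow (L : comNzRingType) (I : set L) (n : nat) : set L :=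
  if n is n'.+1 then submodule_mul setT I (ideal_pow I n') else setT.

Definition noetherian (L : comNzRingType) : Prop :=
  forall I : set L, ideal I -> fin_gen setT I.

Definition maximal_ideal (L : comNzRingType) (m : set L) : Prop :=
  [/\ ideal m, m <> setT &
      forall I : set L, ideal I -> m `<=` I -> I = m \/ I = setT].

(* L -> lim L / m^n is injective and surjective. *)
Definition adically_complete (L : comNzRingType) (m : set L) : Prop :=
  (forall x, (forall n, ideal_pow m n x) -> x = 0) /\
  (forall u : nat -> L, (forall n, ideal_pow m n (u n.+1 - u n)) ->
     exists l : L, forall n, ideal_pow m n (l - u n)).

Definition complete_local (L : comNzRingType) : Prop :=
  exists2 m : set L, maximal_ideal m &
    (forall m' : set L, maximal_ideal m' -> m' = m) /\ adically_complete m.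

(* A is separable over K when A (x)_K A contains a separability idempotent
   \sum_i x_i (x) y_i, i.e. when the multiplication A (x)_K A -> A splits as a
   map of A-bimodules.  The equality
     \sum_i a x_i (x) y_i = \sum_i x_i (x) y_i a
   of tensors is tested against all bilinear forms on A.               *)
Definition separable_algebra (K : fieldType) (A : falgType K) : Prop :=
  exists (n : nat) (x y : 'I_n -> A),
    \sum_i x i * y i = 1 /\
    forall (a : A) (B : {biscalar A}),
      \sum_i B (a * x i) (y i) = \sum_i B (x i) (y i * a).

Definition fin_gen_module (T : nzRingType) (M : lmodType T) : Prop :=
  exists (n : nat) (e : 'I_n -> M),
    forall x : M, exists c : 'I_n -> T, x = \sum_i c i *: e i.

(* The L-algebra R, identified with its image in A, is an L-order in A. *)
Definition is_order (L : idomainType) (A : falgType {fraction L})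
    (R : algType L) (iota : {rmorphism R -> A}) : Prop :=
  [/\ injective iota,
      forall (l : L) (r : R), iota (l *: r) = tofrac l *: iota r,
      fin_gen_module R &
      forall a : A, exists (n : nat) (c : 'I_n -> {fraction L}) (r : 'I_n -> R),
        a = \sum_i c i *: iota (r i)].

(* A ring morphism rho : A -> M_n(E), n >= 1, whose image spans M_n(E) over E
   maps the center to scalars, hence kills all simple components of A but one,
   say B; it embeds Z(B) in E and induces E (x)_Z(B) B = M_n(E).  So E is a
   splitting field of B, and all splittings of all simple components of A
   are obtained in this way.                                          *)
Definition splitting (A : nzRingType) (E : fieldType) (n : nat)
    (rho : {rmorphism A -> 'M[E]_n.+1}) : Prop :=
  forall X : 'M[E]_n.+1, exists (k : nat) (c : 'I_k -> E) (x : 'I_k -> A),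
    X = \sum_i c i *: rho (x i).

(* z in Z(A) = Z(M_a(A)) is the reduced norm of H : its component in each
   simple component of A is the determinant of H after any splitting. *)
Definition is_reduced_norm (K : fieldType) (A : falgType K) (a : nat)
    (H : 'M[A]_a) (z : A) : Prop :=
  z \in 'Z({: A})%AS /\
  forall (E : fieldType) (n : nat) (rho : {rmorphism A -> 'M[E]_n.+1}),
    splitting rho ->
    rho z = (\det (\mxblock_(i < a, j < a) rho (H i j)))%:M.

Definition Nrd (K : fieldType) (A : falgType K) (a : nat) (H : 'M[A]_a) : A :=
  xget 0 [set z | is_reduced_norm H z].

Definition center (T : nzRingType) : set T :=
  [set x | forall y, x * y = y * x].

Section Fitting.

Variables (L : idomainType) (A : falgType {fraction L}).
Variables (R : algType L) (iota : {rmorphism R -> A}).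

Definition nrd (a : nat) (H : 'M[R]_a) : A := Nrd (map_mx iota H).

Definition nrd_ring : set A :=
  span (iota @` @center R)
       [set z | exists (a : nat) (H : 'M[R]_a.+1), z = nrd H].

(* The localization of nrd_ring at the reduced norms of elements of S can be
   taken inside Z(A): these reduced norms are units of Z(A) when 0 is not in S. *)
Definition nrd_ring_loc (S : set L) : set A :=
  [set z | exists x s, [/\ nrd_ring x, S s &
     z = x / nrd (const_mx s%:A : 'M[R]_1)]].

(* Elements of the left module R^a are row vectors, so that the matrix h with
   b rows and a columns is the left R-linear map R^b -> R^a, u |-> u h, and the
   images of the standard basis vectors of R^b are the rows of h.      *)
Definition presents (M : lmodType R) (a b : nat) (h : 'M[R]_(b, a)) : Prop :=
  exists pi : {linear 'rV[R]_a -> M},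
    (forall x : M, exists u, pi u = x) /\
    (forall u, pi u = 0 <-> exists v : 'rV[R]_b, u = v *m h).

Definition quadratic_presentation (M : lmodType R) : Prop :=
  exists (a : nat) (h : 'M[R]_a), presents M h.

Definition Fitt (a b : nat) (h : 'M[R]_(b, a)) : set A :=
  span nrd_ring
    [set z | exists2 f : 'I_a -> 'I_b,
       (forall i j : 'I_a, (i < j)%N -> (f i < f j)%N) & z = nrd (rowsub f h)].

Definition Fitt_ideals (M : lmodType R) : set (set A) :=
  [set I | exists (a b : nat) (h : 'M[R]_(b, a)), presents M h /\ I = Fitt h].

Definition Fitt_max (M : lmodType R) : set A :=
  xget set0 [set I | Fitt_ideals M I /\
                     forall J, Fitt_ideals M J -> I `<=` J -> J = I].

Definition Omega (S : set L) : set (set A) :=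
  [set X | X `<=` nrd_ring_loc S /\ fin_gen nrd_ring X].

End Fitting.

Definition projective (R : nzRingType) (P : lmodType R) : Prop :=
  forall (M N : lmodType R) (g : {linear M -> N}) (f : {linear P -> N}),
    (forall y, exists x, g x = y) ->
    exists h : {linear P -> M}, forall x, g (h x) = f x.

Definition short_exact (R : nzRingType) (M1 M2 M3 : lmodType R)
    (f : {linear M1 -> M2}) (g : {linear M2 -> M3}) : Prop :=
  [/\ injective f,
      forall y, g y = 0 <-> exists x, f x = y &
      forall z, exists y, g y = z].

Definition pd_le1 (R : nzRingType) (P : lmodType R) : Prop :=
  exists (P1 P0 : lmodType R) (f : {linear P1 -> P0}) (g : {linear P0 -> P}),
    [/\ projective P1, projective P0 & short_exact f g].

Section FittingInvariant.

Variables (L : idomainType) (R : algType L) (S : set L).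

Definition catM (M : lmodType R) : Prop :=
  fin_gen_module M /\
  forall x : M, exists2 s : L, S s & (s%:A : R) *: x = 0.

Definition catP (P : lmodType R) : Prop := catM P /\ pd_le1 P.

Record comm_monoid (T : Type) (W : set T) (mul : T -> T -> T) (one : T)
    : Prop := CommMonoid {
  cm_one : W one;
  cm_mul : forall x y, W x -> W y -> W (mul x y);
  cm_mulA : forall x y z, W x -> W y -> W z ->
              mul x (mul y z) = mul (mul x y) z;
  cm_mulC : forall x y, W x -> W y -> mul x y = mul y x;
  cm_mul1 : forall x, W x -> mul one x = x }.

(* F restricts to a Fitting invariant on the objects of the category catM, with
   values in the commutative monoid with underlying set W.             *)
Record fitting_invariant (T : Type) (W : set T) (mul : T -> T -> T) (one : T)
    (F : lmodType R -> T) : Prop := FittingInvariant {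
  fi_monoid : comm_monoid W mul one;
  fi_val : forall M, catM M -> W (F M);
  fi_unit : forall P, catP P -> exists2 y, W y & mul (F P) y = one;
  fi_exact : forall (M' M P : lmodType R)
      (f : {linear M' -> M}) (g : {linear M -> P}),
    catM M' -> catM M -> catP P -> short_exact f g ->
    F M = mul (F P) (F M') }.

End FittingInvariant.

(* Main.v *)
From HB Require Import structures.
Require Import Defs.
From mathcomp Require Import all_boot all_order all_fingroup all_algebra all_field.
From mathcomp Require Import boolp classical_sets.

Set Implicit Arguments.
Unset Strict Implicit.
Unset Printing Implicit Defensive.

Import GRing.Theory VectorInternalTheory.
Local Open Scope ring_scope.
Local Open Scope classical_set_scope.
Local Notation span := Defs.span.

(**
The reduced norm is constructed from the separability idempotent alone.  For a
splitting [rho] of [A], the functionals [X |-> \sum_i rho (x i) X rho (y i)] separate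
matrices and take values in the field [rho 'Z(A)] on [rho A].  The characteristic
polynomial of a matrix with a cyclic vector is therefore the unique solution of a linear
system over that field, so it has coefficients there; a general matrix is reached through
a curve over the polynomial ring whose generic member has a cyclic vector.

Let [Y] be a lattice stable under [rho R] and [X] the [L]-module generated by the
determinants of matrices with rows in [Y].  The multiplier ring of [X] contains the
determinants of [rho r] for [r] in [R], and also those of all block matrices [H], by
Gaussian elimination in [1 + X H] over power series.  Hence the ring of reduced norms is a
noetherian [L]-module.

Two presentations of [M] can be joined into one whose Fitting ideal contains both others,
so the union [J M] of the Fitting ideals is the maximal one: it is generated by the reduced
norms of square matrices of relations between generators of [M].  If [P] has a quadratic
presentation [h] and [0 -> M' -> M -> P -> 0] is exact, then a square relation matrix
of [M] is, after adding generators, the product of one of [M'] with a block matrix of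
reduced norm [Nrd h].  Hence [J M = Nrd h * J M'], while torsion of [P] makes [Nrd h]
invertible after localization.
*)

(** * Morphisms, subfields and the Casimir element *)

(** The reduced norm is specified by all splittings at once, and two splittings of one component may
    live over fields with no given common extension. Rationality is therefore proved for pairs: the
    center of the component is a field [F] embedded in both [E] and [E'], the linear system has
    coefficients in [F[X]], and a single element of [F] is both determinants. The central
    idempotents that isolate a component come from von Neumann regularity of the center, obtained by
    averaging with the separability idempotent. Reduced norms of matrices of all sizes enter the
    ring of norms, so its finiteness needs a reduction to size one. Over [R] a pivot need not be
    invertible; the pivots of [1 + X H] are invertible modulo every power of [X]. Finiteness matters
    because a Fitting ideal belongs to one presentation: the union of all of them is reached only if
    finitely many of its elements generate it. *)

Lemma rmorph_of_rel (R S : pzRingType) (G : R -> S -> Prop) :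
  (forall x, exists y, G x y) ->
  (forall x y y', G x y -> G x y' -> y = y') ->
  G 1 1 -> (forall x y x' y', G x y -> G x' y' -> G (x - x') (y - y')) ->
  (forall x y x' y', G x y -> G x' y' -> G (x * x') (y * y')) ->
  exists f : {rmorphism R -> S}, forall x y, G x y -> f x = y.
Proof.
move=> Gtot Gfun G1 GB GM.
have [f Gf] : {f : R -> S & forall x, G x (f x)} by apply: choice.
have fP x y : G x y -> f x = y by move=> Gxy; apply: Gfun (Gf x) Gxy.
have fB : zmod_morphism f by move=> x y; apply: fP; apply: GB.
have fM : monoid_morphism f.
  by split=> [|x y]; apply: fP => //; apply: GM.
pose fA := GRing.isZmodMorphism.Build _ _ f fB.
pose fX := GRing.isMonoidMorphism.Build _ _ f fM.
by exists (HB.pack_for {rmorphism R -> S} f fA fX).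
Qed.

Section Subfield.
Variables (E : fieldType) (P : E -> Prop).
Hypotheses (P1 : P 1) (PB : forall x y, P x -> P y -> P (x - y)).
Hypotheses (PM : forall x y, P x -> P y -> P (x * y)).
Hypotheses (PV : forall x, P x -> P x^-1).

Let S : {pred E} := fun x => `[< P x >].

Let divS : divring_closed S.
Proof.
split=> [|x y|x y]; rewrite -?topredE /= /S; first exact/asboolP.
  by move=> /asboolP Px /asboolP Py; apply/asboolP/PB.
by move=> /asboolP Px /asboolP Py; apply/asboolP/PM => //; apply: PV.
Qed.

HB.instance Definition _ := GRing.isDivringClosed.Build E S divS.

Record subfield_of := Subfield_of {subfield_val :> E; _ : subfield_val \in S}.

HB.instance Definition _ := [isSub for subfield_val].
HB.instance Definition _ := [Choice of subfield_of by <:].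
HB.instance Definition _ := [SubChoice_isSubComUnitRing of subfield_of by <:].
HB.instance Definition _ := [SubComUnitRing_isSubIntegralDomain of subfield_of by <:].
HB.instance Definition _ := [SubIntegralDomain_isSubField of subfield_of by <:].

Lemma subfield_ext : exists (F : fieldType) (phi : {rmorphism F -> E}),
  forall x, P x <-> exists y, phi y = x.
Proof.
exists subfield_of, (val : subfield_of -> E) => x; split.
  by move=> /asboolP Px; exists (Subfield_of Px).
by case=> -[y Sy] <- /=; apply/asboolP.
Qed.

End Subfield.

Section Casimir.
Variables (K : fieldType) (A : falgType K).

(** Separability is tested only against [K]-valued bilinear forms. Expanding both arguments in a
    basis of [A] reduces any balanced biadditive map to products of coordinates, so [Psi] may take
    values in matrices over another field. *)
Lemma casimir_balanced (n : nat) (x y : 'I_n -> A) (U : zmodType)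
    (Psi : A -> A -> U) :
  (forall (a : A) (B : {biscalar A}),
      \sum_i B (a * x i) (y i) = \sum_i B (x i) (y i * a)) ->
  (forall u v w, Psi (u + v) w = Psi u w + Psi v w) ->
  (forall u v w, Psi u (v + w) = Psi u v + Psi u w) ->
  (forall k u v, Psi (k *: u) v = Psi u (k *: v)) ->
  forall a, \sum_i Psi (a * x i) (y i) = \sum_i Psi (x i) (y i * a).
Proof.
move=> cas PsiDl PsiDr PsiZ a.
have Psi0l v : Psi 0 v = 0.
  by apply: (addrI (Psi 0 v)); rewrite -PsiDl !addr0.
have Psi0r v : Psi v 0 = 0.
  by apply: (addrI (Psi v 0)); rewrite -PsiDr !addr0.
have sumPl I (r : seq I) (f : I -> A) v : Psi (\sum_(i <- r) f i) v = \sum_(i <- r) Psi (f i) v.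
  by apply: (big_morph (fun u => Psi u v)) => // u w; apply: PsiDl.
have sumPr I (r : seq I) (f : I -> A) v : Psi v (\sum_(i <- r) f i) = \sum_(i <- r) Psi v (f i).
  exact: (big_morph (Psi v)).
pose b := vbasis {:A}.
have bP u : u = \sum_j coord b j u *: b`_j by apply: coord_vbasis; rewrite memvf.
have PsiE u v : Psi u v = \sum_j \sum_k Psi ((coord b j u * coord b k v) *: b`_j) b`_k.
  rewrite {1}(bP u) {1}(bP v) sumPl; apply: eq_bigr => j _.
  rewrite sumPr; apply: eq_bigr => k _; rewrite -PsiZ scalerA mulrC.
  by [].
have bil j k : exists B : {biscalar A}, forall u v, B u v = coord b j u * coord b k v.
  pose f u v : K := coord b j u * coord b k v.
  have fB : bilinear_for *%R *%R f.
    split=> [u' c u v|u c v w]; rewrite /f linearP /=; first by rewrite mulrDl mulrA.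
    by rewrite mulrDr mulrCA.
  pose fI := bilinear_isBilinear.Build _ _ _ _ _ _ f fB.
  by exists (HB.pack_for {biscalar A} f fI).
under eq_bigr do rewrite PsiE; under [RHS]eq_bigr do rewrite PsiE.
rewrite exchange_big [RHS]exchange_big /=; apply: eq_bigr => j _.
rewrite exchange_big [RHS]exchange_big /=; apply: eq_bigr => k _.
rewrite -!sumPl -!scaler_suml; congr (Psi (_ *: _) _).
have [B BE] := bil j k.
by under eq_bigr do rewrite -BE; under [RHS]eq_bigr do rewrite -BE.
Qed.

End Casimir.

Lemma centerE (K : fieldType) (A : falgType K) (z : A) :
  z \in 'Z({: A})%AS <-> center z.
Proof.
rewrite memv_cap memvf /=; split=> [/centvP zP y|zP]; first by rewrite zP ?memvf.
by apply/centvP => y _.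
Qed.

Section Center.
Variable T : nzRingType.
Implicit Types z w : T.

Lemma center0 : center (0 : T). Proof. by move=> y; rewrite mul0r mulr0. Qed.
Lemma center1 : center (1 : T). Proof. by move=> y; rewrite mul1r mulr1. Qed.
Lemma centerB z w : center z -> center w -> center (z - w).
Proof. by move=> zC wC y; rewrite mulrBl mulrBr zC wC. Qed.
Lemma centerD z w : center z -> center w -> center (z + w).
Proof. by move=> zC wC y; rewrite mulrDl mulrDr zC wC. Qed.
Lemma centerM z w : center z -> center w -> center (z * w).
Proof. by move=> zC wC y; rewrite -mulrA wC mulrA zC mulrA. Qed.

End Center.

Section Separable.
Variables (K : fieldType) (A : falgType K).
Hypothesis sepA : separable_algebra A.

(** Averaging by the separability idempotent projects [A] onto its center: multiplying the average
    by [b] on either side gives the two sides of the balanced identity for [u * a * v]. *)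
Lemma center_proj (n : nat) (x y : 'I_n -> A) :
  \sum_i x i * y i = 1 ->
  (forall (a : A) (B : {biscalar A}),
      \sum_i B (a * x i) (y i) = \sum_i B (x i) (y i * a)) ->
  (forall a, center (\sum_i x i * a * y i)) /\
  (forall z, center z -> \sum_i x i * z * y i = z).
Proof.
move=> xy1 cas; split=> [a b|z zC]; last first.
  under eq_bigr do rewrite -zC -mulrA.
  by rewrite -mulr_sumr xy1 mulr1.
transitivity (\sum_i x i * a * (y i * b)).
  by rewrite mulr_suml; apply: eq_bigr => i _; rewrite mulrA.
transitivity (\sum_i b * x i * a * y i); last first.
  by rewrite mulr_sumr; apply: eq_bigr => i _; rewrite !mulrA.
apply/esym; apply: (casimir_balanced (Psi := fun u v => u * a * v)) => //.
- by move=> u v w; rewrite !mulrDl.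
- by move=> u v w; rewrite !mulrDr.
- by move=> k u v; rewrite -!scalerAl -scalerAr.
Qed.

(** A Maschke argument: a [K]-linear projection onto the left ideal [A w] is averaged by the
    separability idempotent. This regularity is the source of central idempotents. *)
Lemma center_regular (w : A) : center w -> exists2 u, center u & w = u * w * w.
Proof.
move=> wC; have [n [x [y [xy1 cas]]]] := sepA.
have [cC cZ] := center_proj xy1 cas.
pose U := (amulr w @: fullv)%VS; pose p := projv U.
have Uw a : a * w \in U.
  by apply/memv_imgP; exists a; rewrite ?memvf // lfunE.
have UP b : b \in U -> exists a, b = a * w.
  by case/memv_imgP => a _; rewrite lfunE /=; exists a.
have [t tP] : {t : 'I_n -> A & forall i, p (y i) = t i * w}.
  by apply: (choice (P := fun i ti => p (y i) = ti * w)) => i; apply/UP/memv_proj.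
(* Each [y i * w] lies in [U] and is fixed by [p]; the balanced identity then moves [w] from the
   right of [y i] to the left of [x i]. *)
have wE : w = w * (\sum_i x i * t i) * w.
  rewrite -{1}[w]mul1r -xy1 mulr_suml.
  under eq_bigr => i _ do rewrite -mulrA -[y i * w](projv_id (Uw _)) -/p.
  rewrite -(casimir_balanced (Psi := fun u v => u * p v)) //.
  - under eq_bigr => i _ do rewrite tP mulrA -[w * x i * t i]mulrA.
    by rewrite -mulr_suml -mulr_sumr.
  - by move=> u v b; rewrite mulrDl.
  - by move=> u v b; rewrite linearD mulrDr.
  - by move=> k u v; rewrite linearZ -scalerAl -scalerAr.
(* The inner sum is a quasi-inverse of [w] but need not be central; its average is central and still
   works because [w * w] is central. *)
exists (\sum_i x i * (\sum_i x i * t i) * y i); first exact: cC.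
set u := \sum_i x i * t i in wE *.
rewrite -{1}(cZ w wC) {1}wE !mulr_suml; apply: eq_bigr => i _.
have wwC : center (w * w) by apply: centerM.
have -> : w * u * w = u * (w * w) by rewrite (wC u) mulrA.
by rewrite -(wwC u) mulrA -(wwC (x i)) -!mulrA (mulrA w w) (wwC (x i * _)) !mulrA.
Qed.

Lemma center_idem (w : A) : center w ->
  exists u g, [/\ center u, center g, g = u * w, g * g = g & g * w = w].
Proof.
move=> wC; have [u uC wE] := center_regular wC.
have wuw : u * w * w = w by [].
exists u, (u * w); split=> //; first exact: centerM.
by rewrite mulrA -(mulrA u w u) (wC u) mulrA -(mulrA (u * u)) -!mulrA; congr (u * _); rewrite !mulrA.
Qed.

End Separable.

(** * Splitting representations *)

Lemma irreducible_divisor (E : fieldType) (p : {poly E}) :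
  (1 < size p)%N -> exists2 q, irreducible_poly q & q %| p.
Proof.
have [n] := ubnP (size p); elim: n p => // n IHn p; rewrite ltnS => pn p_gt1.
have p0 : p != 0 by rewrite -size_poly_gt0 ltnW.
have [irr|] := pselect (irreducible_poly p); first by exists p.
move=> /not_andP [//|/existsNP [q /not_implyP [q1 /not_implyP [qp nqp]]]].
have q0 : q != 0 by apply: contraNneq p0 => q0; rewrite -dvd0p -q0.
have sq : (size q < size p)%N.
  rewrite ltn_neqAle dvdp_leq // andbT; apply/eqP => sqp; apply: nqp.
  by rewrite -dvdp_size_eqp // sqp.
have [|d irr dq] := IHn q (leq_trans sq pn).
  by rewrite ltn_neqAle eq_sym q1 size_poly_gt0.
by exists d => //; apply: dvdp_trans dq qp.
Qed.

Lemma root_extension (E : fieldType) (p : {poly E}) :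
  (1 < size p)%N ->
  exists (E' : fieldType) (phi : {rmorphism E -> E'}) (x : E'),
    root (map_poly phi p) x.
Proof.
move=> /irreducible_divisor [q /irredp_FAdjoin [L _ [x qx _]] qp].
by exists L, (in_alg L), x; apply: root_dvdp qx; rewrite dvdp_map.
Qed.

Section Representations.
Variables (K : fieldType) (A : falgType K).

Definition is_rep (E : fieldType) (sigma : {rmorphism K -> E}) (n : nat)
    (r : A -> 'M[E]_n) : Prop :=
  [/\ forall a b, r (a + b) = r a + r b,
      forall k a, r (k *: a) = sigma k *: r a,
      forall a b, r (a * b) = r a *m r b & r 1 = 1%:M].

Lemma rep_restrict (E : fieldType) (sigma : {rmorphism K -> E}) (m n : nat)
    (r : A -> 'M[E]_n) (U : 'M_(m, n)) :
  is_rep sigma r -> row_free U -> (forall a, (U *m r a <= U)%MS) ->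
  is_rep sigma (fun a => U *m r a *m pinvmx U).
Proof.
move=> [rD rZ rM r1] Ufree Ur; split=> [a b|k a|a b|].
- by rewrite rD mulmxDr mulmxDl.
- by rewrite rZ -scalemxAr -scalemxAl.
- rewrite rM (mulmxA U) -{1}(mulmxKpV (Ur a)).
  by rewrite -!(mulmxA (U *m r a *m pinvmx U)) -(mulmxA U).
- by rewrite r1 mulmx1 mulmxVp.
Qed.

Lemma rep_map (E E' : fieldType) (sigma : {rmorphism K -> E})
    (phi : {rmorphism E -> E'}) (n : nat) (r : A -> 'M[E]_n) :
  is_rep sigma r -> is_rep (phi \o sigma : {rmorphism K -> E'}) (fun a => map_mx phi (r a)).
Proof.
move=> [rD rZ rM r1]; split=> [a b|k a|a b|].
- by rewrite rD map_mxD.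
- by rewrite rZ map_mxZ.
- by rewrite rM map_mxM.
- by rewrite r1 map_mx1.
Qed.

Lemma regular_rep : exists r : A -> 'M[K]_(dim A),
  is_rep (idfun : {rmorphism K -> K}) r /\ forall a, r a = 0 -> a = 0.
Proof.
pose r a := lin1_mx (v2r \o (amulr a) \o r2v : 'rV[K]_(dim A) -> 'rV[K]_(dim A)).
have rE a v : v *m r a = v2r (r2v v * a).
  by rewrite mul_rV_lin1 /= lfunE /=.
have rP a (b : 'M_(dim A)) : (forall v : 'rV_(dim A), v *m r a = v *m b) -> r a = b.
  by move=> ab; apply/row_matrixP => i; rewrite !rowE.
exists r; split; last first.
  move=> a ra. have := rE a (v2r 1).
  by rewrite v2rK mul1r ra mulmx0 => /esym/(canRL v2rK); rewrite linear0.
split=> [a b|k a|a b|]; apply: rP => v.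
- by rewrite rE mulmxDr !rE mulrDr linearD.
- by rewrite rE -scalemxAr rE -scalerAr linearZ.
- by rewrite mulmxA !rE v2rK mulrA.
- by rewrite rE mulr1 r2vK mulmx1.
Qed.

(* A choice of [E] and [r] of minimal dimension is absolutely irreducible: eigenspaces of intertwiners over extensions of [E] are
   subrepresentations. *)
Lemma minimal_rep (g : A) : center g -> g * g = g -> g != 0 ->
  exists (E : fieldType) (sigma : {rmorphism K -> E}) (n : nat) (r : A -> 'M[E]_n.+1),
    [/\ is_rep sigma r, r g = 1%:M,
        forall m (U : 'M_(m, n.+1)), U != 0 -> (forall a, (U *m r a <= U)%MS) ->
          row_full U &
        forall T, (forall a, T *m r a = r a *m T) -> is_scalar_mx T].
Proof.
move=> gC gg g0.
pose P n := `[< exists (E : fieldType) (sigma : {rmorphism K -> E}) (r : A -> 'M[E]_n),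
  [/\ is_rep sigma r, r g = 1%:M & (0 < n)%N] >].
(* Every nonzero invariant subspace on which [g] acts as the identity puts its rank into [P];
   minimality is tested against such ranks. *)
have sub (E : fieldType) (sigma : {rmorphism K -> E}) n (r : A -> 'M[E]_n) m (U : 'M_(m, n)) :
  is_rep sigma r -> U != 0 -> (forall a, (U *m r a <= U)%MS) -> U *m r g = U -> P (\rank U).
  move=> rrep U0 Ur Ug; apply/asboolP.
  have Vr a : (row_base U *m r a <= row_base U)%MS.
    rewrite (eqmxMr _ (eq_row_base U)) (submx_trans (Ur a)) //.
    by rewrite eq_row_base.
  exists E, sigma, (fun a => row_base U *m r a *m pinvmx (row_base U)); split.
  - exact: rep_restrict rrep (row_base_free U) Vr.
  - have -> : row_base U *m r g = row_base U.
      have /submxP [D ->] : (row_base U <= U)%MS by rewrite eq_row_base.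
      by rewrite -mulmxA Ug.
    by rewrite mulmxVp ?row_base_free.
  - by rewrite lt0n mxrank_eq0.
have exP : exists n, P n.
  have [r [rrep rinj]] := regular_rep; have [rD rZ rM r1] := rrep.
  exists (\rank (r g)); apply: (sub _ _ _ _ _ _ rrep).
  - by apply: contra_neq g0 => /rinj.
  - by move=> a; rewrite -rM gC rM submxMl.
  - by rewrite -rM gg.
case: (ex_minnP exP) => n /asboolP [E [sigma [r [rrep rg n0]]]] nmin.
case: n n0 => // n _ in r rrep rg nmin *; have [rD rZ rM r1] := rrep.
exists E, sigma, n, r; split=> // [m U U0 Ur|T Tr].
  by rewrite -col_leq_rank; apply/nmin/(sub _ _ _ _ _ _ rrep U0 Ur); rewrite rg mulmx1.
(* [P] ranges over all fields, so the size stays minimal over an extension containing an eigenvalue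
   of [T]. The eigenspace is then everything, and [T] is scalar over [E'], hence over [E]. *)
have [|E' [phi [lam root_lam]]] := @root_extension E (char_poly T).
  by rewrite size_char_poly.
rewrite map_char_poly -eigenvalue_root_char /eigenvalue in root_lam.
rewrite -(map_mx_is_scalar phi); set T' := map_mx phi T in root_lam *.
set U := eigenspace T' lam in root_lam.
have UT : U *m T' = lam *: U by apply/eigenspaceP.
have : row_full U.
  rewrite -col_leq_rank; apply/nmin/(sub _ _ _ _ _ _ (rep_map phi rrep) root_lam).
    move=> a; apply/eigenspaceP.
    by rewrite -mulmxA -map_mxM -Tr map_mxM mulmxA UT -scalemxAl.
  by rewrite rg map_mx1 mulmx1.
rewrite -sub1mx => /eigenspaceP; rewrite mul1mx => ->.
by rewrite scalemx1 scalar_mx_is_scalar.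
Qed.

End Representations.

Lemma span_over_fin (V : Type) (E : fieldType) (U : lmodType E) (I : finType)
    (f : V -> U) (c : I -> E) (x : I -> V) :
  exists (k : nat) (c' : 'I_k -> E) (x' : 'I_k -> V),
    \sum_i c i *: f (x i) = \sum_i c' i *: f (x' i).
Proof.
exists #|I|, (c \o enum_val), (x \o enum_val) => /=.
by rewrite (reindex _ (onW_bij _ (enum_val_bij I))).
Qed.

Section Splitting.
Variables (K : fieldType) (A : falgType K).
Hypothesis sepA : separable_algebra A.

(** Burnside's theorem for the minimal representation. The average [T Y] of any matrix is an
    intertwiner, hence scalar; read entry by entry, this exhibits matrices with a single nonzero row
    in the span of the image, and irreducibility makes such rows span. *)
Lemma splitting_exists (g : A) : center g -> g * g = g -> g != 0 ->
  exists (E : fieldType) (n : nat) (rho : {rmorphism A -> 'M[E]_n.+1}),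
    splitting rho /\ rho g = 1.
Proof.
move=> gC gg g0; have [E [sigma [n [r [rrep rg rirr rsc]]]]] := minimal_rep gC gg g0.
have [rD rZ rM r1] := rrep.
have rB : zmod_morphism r.
  by move=> a b; rewrite rD -[- b]scaleN1r rZ rmorphN1 scaleN1r.
pose rA := GRing.isZmodMorphism.Build _ _ r rB.
pose rX := GRing.isMonoidMorphism.Build _ _ r (conj r1 rM).
pose rho := HB.pack_for {rmorphism A -> 'M[E]_n.+1} r rA rX.
have rsum m (f : 'I_m -> A) : r (\sum_i f i) = \sum_i r (f i) by exact: (raddf_sum rho).
exists E, n, rho; split=> // X.
have [k [x [y [xy1 cas]]]] := sepA.
pose T Y := \sum_i r (x i) *m Y *m r (y i).
have Tsc Y : is_scalar_mx (T Y).
  apply: rsc => a; rewrite /T mulmx_suml mulmx_sumr.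
  transitivity (\sum_i r (x i) *m Y *m r (y i * a)).
    by apply: eq_bigr => i _; rewrite rM mulmxA.
  rewrite -(casimir_balanced (Psi := fun u v => r u *m Y *m r v)) //.
  - by apply: eq_bigr => i _; rewrite rM !mulmxA.
  - by move=> u v w; rewrite rD !mulmxDl.
  - by move=> u v w; rewrite rD mulmxDr.
  - by move=> c u v; rewrite !rZ -!scalemxAl -scalemxAr.
(* The averages of the diagonal matrix units add up to [T 1 = 1], so they do not all vanish. *)
have [p Tp] : exists p, T (delta_mx p p) != 0.
  apply/existsP; rewrite -negb_forall; apply: contraPN (oner_neq0 'M[E]_n.+1).
  move=> /forallP T0; apply/negP; rewrite negbK; apply/eqP.
  rewrite -[RHS](big1_eq (index_enum 'I_n.+1) xpredT (op := +%R)).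
  transitivity (T 1%:M).
    rewrite /T; transitivity (r (\sum_i x i * y i)); first by rewrite xy1.
    rewrite rsum; apply: eq_bigr => i _.
    by rewrite mulmx1 -rM.
  transitivity (\sum_q T (delta_mx q q)); last by apply: eq_bigr => q _; apply/eqP.
  rewrite mx1_sum_delta /T exchange_big; apply: eq_bigr => i _ /=.
  by rewrite mulmx_sumr mulmx_suml.
have TE c q a s : T (delta_mx c q) a s = \sum_i r (x i) a c * r (y i) q s.
  rewrite /T summxE; apply: eq_bigr => i _.
  rewrite -[delta_mx c q](mul_delta_mx (0 : 'I_1)) mulmxA -colE -mulmxA -rowE.
  by rewrite mxE big_ord1 !mxE.
have Tsc' Y a s : T Y a s = T Y 0 0 *+ (a == s).
  by have /is_scalar_mxP [t ->] := Tsc Y; rewrite !mxE eqxx.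
(* By [TE], the sum of the [r (x i)] with coefficients [r (y i) p s] is the matrix with row [s]
   equal to [mu] and all other rows zero. *)
pose mu := \row_c T (delta_mx c p) 0 0.
have mu0 : mu != 0.
  apply: contraNneq Tp => /rowP/(_ p); rewrite !mxE => mup.
  by apply/eqP/matrixP => a s; rewrite Tsc' mup mul0rn mxE.
pose b := vbasis {:A}.
have bE a : a = \sum_j coord b j a *: b`_j by apply: coord_vbasis; rewrite memvf.
pose U := \matrix_(j < \dim {:A}) (mu *m r b`_j).
have muU a : (mu *m r a <= U)%MS.
  rewrite (bE a) rsum mulmx_sumr summx_sub // => j _.
  rewrite /= rZ -scalemxAr scalemx_sub //.
  have <- : row j U = mu *m r b`_j by rewrite rowK.
  exact: row_sub.
have Ufull : row_full U.
  apply: rirr => [|a].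
    by apply: contraNneq mu0 => U0; have := muU 1; rewrite U0 r1 mulmx1 => /submx0null ->.
  by apply/row_subP => j; rewrite row_mul rowK -mulmxA -rM muU.
have /row_fullP [D DU] := Ufull.
(* [X *m D] holds the coordinates of the rows of [X] in the spanning rows of [U]; the factor
   [r (y i) p s] puts the result in row [s]. *)
pose c (t : 'I_n.+1 * 'I_(\dim {:A}) * 'I_k) := (X *m D) t.1.1 t.1.2 * r (y t.2) p t.1.1.
pose z (t : 'I_n.+1 * 'I_(\dim {:A}) * 'I_k) := x t.2 * b`_t.1.2.
have [k' [c' [x' cxE]]] := span_over_fin rho c z.
exists k', c', x'; rewrite -cxE -[LHS]mulmx1 -DU mulmxA.
apply/matrixP => a e; rewrite mxE summxE.
have TEmu q s : T (delta_mx q p) a s = mu 0 q *+ (a == s) by rewrite Tsc' mxE.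
have inner s j : \sum_i (c (s, j, i) *: rho (z (s, j, i))) a e =
    ((X *m D) s j * U j e) *+ (a == s).
  transitivity ((X *m D) s j * \sum_q T (delta_mx q p) a s * r b`_j q e).
    under [in RHS]eq_bigr => q _ do rewrite TE mulr_suml.
    rewrite exchange_big /= mulr_sumr; apply: eq_bigr => i _.
    rewrite mxE /c /z /= rM mxE -mulrA; congr (_ * _); rewrite mxE mulr_sumr.
    by apply: eq_bigr => q _; rewrite mulrA (mulrC (r (y i) p s)).
  rewrite -mulrnAr; congr (_ * _).
  rewrite mxE -[mu *m _]/(mu *m r b`_j) mxE -sumrMnl; apply: eq_bigr => q _.
  by rewrite TEmu mulrnAl.
rewrite -(pair_bigA _ (fun sj i => (c (sj, i) *: rho (z (sj, i))) a e)) /=.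
rewrite -(pair_bigA _ (fun s j => \sum_i (c (s, j, i) *: rho (z (s, j, i))) a e)) /=.
rewrite (bigD1 a) //= [X in _ + X]big1 ?addr0 => [|s sa].
  by apply: eq_bigr => j _; rewrite inner eqxx mulr1n.
by rewrite big1 // => j _; rewrite inner eq_sym (negPf sa).
Qed.
End Splitting.

(** * Components of a separable algebra *)

Lemma splitting_center (T : nzRingType) (E : fieldType) (n : nat)
    (rho : {rmorphism T -> 'M[E]_n.+1}) (z : T) :
  splitting rho -> center z -> rho z = (rho z 0 0)%:M.
Proof.
move=> spl zC; set Z := rho z.
have ZX X : Z *m X = X *m Z.
  have [k [c [x ->]]] := spl X; rewrite mulmx_sumr mulmx_suml.
  apply: eq_bigr => i _; rewrite -scalemxAr -scalemxAl /Z; congr (_ *: _).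
  by have := congr1 rho (zC (x i)); rewrite !rmorphM.
apply/matrixP => a i; have /matrixP/(_ a 0) := ZX (delta_mx i 0).
rewrite -[delta_mx i 0](mul_delta_mx (0 : 'I_1)) mulmxA -colE -mulmxA -rowE.
by rewrite !mxE !big_ord1 !mxE !eqxx !andbT mulr1 mulr_natl.
Qed.

Section Components.
Variables (K : fieldType) (A : falgType K).
Hypothesis sepA : separable_algebra A.

(** The measure for choosing a minimal central idempotent and for the inductions that split off one
    component at a time. *)
Definition ideal_dim (g : A) : nat := \dim (amulr g @: fullv)%VS.

Lemma ideal_dim_lt (g e : A) :
  center e -> g * g = g -> e * e = e -> e * g = e -> e != 0 ->
  (ideal_dim (g - e)%R < ideal_dim g)%N.
Proof.
move=> eC gg ee eg e0.
have sub : (amulr (g - e) @: fullv <= amulr g @: fullv)%VS.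
  apply/subvP => _ /memv_imgP [a _ ->]; apply/memv_imgP; exists (a * (g - e)).
    exact: memvf.
  by rewrite !lfunE /= -mulrA mulrBl gg eg.
rewrite ltn_neqAle dimvS // andbT; apply: contra_neq e0 => /eqP eqd.
have eqV : (amulr g @: fullv <= amulr (g - e) @: fullv)%VS.
  have := eqEdim (amulr (g - e) @: fullv) (amulr g @: fullv).
  by rewrite sub -/(ideal_dim g) -/(ideal_dim (g - e)) (eqP eqd) leqnn => /eqP ->.
have : e \in (amulr (g - e) @: fullv)%VS.
  by apply: (subvP eqV); apply/memv_imgP; exists e; rewrite ?memvf // lfunE /= eg.
case/memv_imgP => a _; rewrite lfunE /= => ea.
have : e * e = a * (g - e) * e by rewrite {1}ea.
by rewrite ee -mulrA mulrBl ee -(eC g) eg subrr mulr0.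
Qed.

Section Component.
Variables (E : fieldType) (n : nat) (rho : {rmorphism A -> 'M[E]_n.+1}).
Hypothesis spl : splitting rho.

(** [e] has minimal [ideal_dim] among the central idempotents that [rho] sends to 1. If [rho z = 0]
    and [z * e] were nonzero, the idempotent generating the ideal of [z * e] could be subtracted
    from [e] without changing its image. *)
Lemma component : exists e : A,
  [/\ center e, e * e = e, rho e = 1 &
      forall z, center z -> rho z = 0 -> z * e = 0].
Proof.
pose P m := `[< exists e : A,
  [/\ center e, e * e = e, rho e = 1 & ideal_dim e = m] >].
have exP : exists m, P m.
  exists (ideal_dim 1); apply/asboolP; exists 1.
  by split; [exact: center1|rewrite mulr1|rewrite rmorph1|].
case: (ex_minnP exP) => m /asboolP [e [eC ee re <-]] emin.
exists e; split=> // z zC rz.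
have zeC : center (z * e) by apply: centerM.
have [u [g [uC gC gE gg gz]]] := center_idem sepA zeC.
have ge : g * e = g by rewrite gE -!mulrA ee.
have [g0|g0] := eqVneq g 0; first by rewrite -gz g0 mul0r.
have := ideal_dim_lt gC ee gg ge g0.
rewrite ltnNge emin //; apply/asboolP; exists (e - g); split=> //.
- exact: centerB.
- by rewrite mulrBl !mulrBr ee ge gg (eC g) ge subrr subr0.
- by rewrite rmorphB gE !rmorphM rz mul0r mulr0 subr0.
Qed.

Lemma splitting_center_idem (g : A) :
  center g -> g * g = g -> rho g = 0 \/ rho g = 1.
Proof.
move=> gC gg; rewrite (splitting_center spl gC).
have : rho g 0 0 * (rho g 0 0 - 1) = 0.
  have := congr1 rho gg; rewrite rmorphM (splitting_center spl gC).
  rewrite -[_ * _]/(_ *m _) -scalar_mxM => /matrixP/(_ 0 0).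
  by rewrite !mxE eqxx !mulr1n mulrBr mulr1 => ->; rewrite subrr.
move=> /eqP; rewrite mulf_eq0 subr_eq0 => /orP [] /eqP ->; [left|right] => //.
by rewrite scalar_mx0 || rewrite -scalemx1 scale0r.
Qed.

End Component.

(** A nonzero [z - w] has a nonzero central idempotent among its multiples, and a splitting that
    sends this idempotent to 1 cannot kill [z - w]. Uniqueness of the reduced norm follows. *)
Lemma center_sep (z w : A) :
  center z -> center w ->
  (forall (E : fieldType) n (rho : {rmorphism A -> 'M[E]_n.+1}),
     splitting rho -> rho z = rho w) -> z = w.
Proof.
move=> zC wC zw; apply/eqP; rewrite -subr_eq0; apply/negPn/negP => d0.
have dC : center (z - w) by apply: centerB.
have [u [g [uC gC gE gg gz]]] := center_idem sepA dC.
have g0 : g != 0 by apply: contraNneq d0 => g0; rewrite -gz g0 mul0r.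
have [E [n [rho [spl rg]]]] := splitting_exists sepA gC gg g0.
have := rg; rewrite gE rmorphM rmorphB (zw _ _ _ spl) subrr mulr0 => /esym/eqP.
by rewrite oner_eq0.
Qed.

End Components.

(** * Rationality of determinants *)

Lemma fracP (D : idomainType) (x : {fraction D}) :
  exists p q : D, q != 0 /\ x = tofrac p / tofrac q.
Proof.
elim/quotW: x => r; exists (\n_r), (\d_r); split; first exact: denom_ratioP.
have d0 : tofrac (\d_r) != 0 by rewrite tofrac_eq0 denom_ratioP.
rewrite -[LHS](mulfK d0); congr (_ / _).
unlock FracField.tofrac; rewrite -[LHS]FracField.pi_mul; apply/eqmodP.
rewrite /= FracField.equivfE /FracField.mulf !numden_Ratio ?(oner_neq0, mulr1) ?denom_ratioP //.
exact/eqP/mulrC.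
Qed.

Lemma clear_denominators (D : idomainType) (m n : nat) (B : 'M[{fraction D}]_(m, n)) :
  exists (d : D) (B0 : 'M[D]_(m, n)), d != 0 /\ tofrac d *: B = map_mx (@tofrac D) B0.
Proof.
pose P (ij : 'I_m * 'I_n) (pq : D * D) := pq.2 != 0 /\ B ij.1 ij.2 = tofrac pq.1 / tofrac pq.2.
have [f fP] : {f : 'I_m * 'I_n -> D * D & forall ij, P ij (f ij)}.
  apply: choice => ij; have [p [q [q0 e]]] := fracP (B ij.1 ij.2).
  by exists (p, q).
exists (\prod_ij (f ij).2), (\matrix_(i, j) ((f (i, j)).1 * \prod_(ij | ij != (i, j)) (f ij).2)).
split; first by apply/prodf_neq0 => ij _; have [] := fP ij.
apply/matrixP => i j; rewrite !mxE; have [q0 /= ->] := fP (i, j).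
rewrite (bigD1 (i, j)) //= !rmorphM /=; set Q := tofrac (\prod_(_ | _) _).
by rewrite mulrC mulrA divfK ?tofrac_eq0.
Qed.

(** * Cyclic vectors along a polynomial curve of matrices *)

Section Krylov.
Variables (D : idomainType) (n : nat).
Implicit Types (u : 'rV[D]_n) (M b : 'M[D]_n).

Definition krylov (R : comNzRingType) (u : 'rV[R]_n) (M : 'M[R]_n) : 'M[R]_n :=
  \matrix_(k < n) (u *m M ^+ k).

Lemma map_mx_exp (R R' : comNzRingType) (f : {rmorphism R -> R'}) (M : 'M[R]_n) k :
  map_mx f (M ^+ k) = map_mx f M ^+ k.
Proof.
elim: k => [|k IHk]; first by rewrite !expr0 [LHS]map_mx1.
by rewrite !exprS [LHS]map_mxM IHk.
Qed.

Lemma map_krylov (R R' : comNzRingType) (f : {rmorphism R -> R'}) (u : 'rV[R]_n) (M : 'M[R]_n) :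
  map_mx f (krylov u M) = krylov (map_mx f u) (map_mx f M).
Proof.
by apply/row_matrixP => k; rewrite -map_row !rowK map_mxM map_mx_exp.
Qed.

Lemma krylov_free u M (v : 'rV[D]_n) :
  \det (krylov u M) != 0 -> \sum_k v 0 k *: M ^+ k = 0 -> v = 0.
Proof.
move=> d0 vM; have vK : v *m krylov u M = 0.
  rewrite mulmx_sum_row; under eq_bigr => k _ do rewrite rowK scalemxAr.
  by rewrite -mulmx_sumr vM mulmx0.
have : v *m krylov u M *m \adj (krylov u M) = 0 by rewrite vK mul0mx.
rewrite -mulmxA mul_mx_adj mul_mx_scalar => /matrixP vd.
apply/matrixP => i j; have := vd i j; rewrite !mxE => /eqP.
by rewrite mulf_eq0 (negPf d0) => /eqP.
Qed.

(* The Krylov determinant of [M + x b] is a polynomial in [x]. *)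
Lemma krylov_avoid u M b (x t : D) : (forall i j, t ^+ i = t ^+ j -> i = j) ->
  \det (krylov u (M + x *: b)) != 0 ->
  exists k, \det (krylov u (M + t ^+ k.+1 *: b)) != 0.
Proof.
move=> t_inj x0.
pose p := \det (krylov (map_mx polyC u) (map_mx polyC M + 'X *: map_mx polyC b)).
have pE y : p.[y] = \det (krylov u (M + y *: b)).
  rewrite -[p.[y]]/(horner_eval y p) -det_map_mx map_krylov map_mxD map_mxZ.
  rewrite -!map_mx_comp /= /horner_eval hornerX.
  by congr (\det (krylov _ (_ + _ *: _))); apply/matrixP => i j; rewrite !mxE /= hornerC.
have p0 : p != 0 by apply: contraNneq x0 => p0; rewrite -pE p0 horner0.
apply: contrapT => /forallNP pk.
pose rs := [seq t ^+ k.+1 | k <- iota 0 (size p)].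
have : (size rs < size p)%N.
  apply: max_poly_roots p0 _ _.
    apply/allP => _ /mapP [k _ ->]; rewrite rootE pE.
    by apply/negPn/negP; apply: pk.
  by rewrite map_inj_uniq ?iota_uniq // => i j /t_inj [].
by rewrite size_map size_iota ltnn.
Qed.

End Krylov.

Section PolyMatrix.
Variables (B : nzRingType) (C : comNzRingType) (n : nat).
Variable tau : {rmorphism B -> 'M[C]_n}.
Implicit Types (y z : {poly B}).

(** The extension of [tau] to polynomials with [X] central, its values being read as matrices over
    [C[X]]. *)
Definition polymx y : 'M[{poly C}]_n :=
  \matrix_(i, j) \poly_(k < size y) tau y`_k i j.

Lemma coef_polymx y i j k : (polymx y i j)`_k = tau y`_k i j.
Proof.
rewrite mxE coef_poly; case: ltnP => // yk.
by rewrite nth_default // rmorph0 mxE.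
Qed.

Lemma polymxM y z : polymx (y * z) = polymx y *m polymx z.
Proof.
apply/matrixP => i j; apply/polyP => k; rewrite coef_polymx coefM rmorph_sum summxE.
rewrite mxE coef_sum.
under [RHS]eq_bigr => l _ do rewrite coefM.
rewrite exchange_big /=; apply: eq_bigr => l _; rewrite rmorphM mxE.
by apply: eq_bigr => m _; rewrite !coef_polymx.
Qed.

Lemma polymxD y z : polymx (y + z) = polymx y + polymx z.
Proof.
apply/matrixP => i j; apply/polyP => k.
transitivity ((polymx y i j + polymx z i j)`_k); last by rewrite [in RHS]mxE.
by rewrite coefD !coef_polymx coefD rmorphD mxE.
Qed.

Lemma polymxC c : polymx c%:P = map_mx polyC (tau c).
Proof.
apply/matrixP => i j; apply/polyP => k; rewrite coef_polymx [map_mx _ _ i j]mxE !coefC.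
by case: eqP => // _; rewrite rmorph0 mxE.
Qed.

Lemma polymxX y k : polymx (y ^+ k) = polymx y ^+ k.
Proof.
elim: k => [|k IHk]; last by rewrite !exprS polymxM IHk.
by rewrite !expr0 polymxC rmorph1 map_mx1.
Qed.

Lemma polymxZXn k c : polymx (c%:P * 'X^k) = 'X^k *: map_mx polyC (tau c).
Proof.
apply/matrixP => i j; apply/polyP => l; rewrite coef_polymx coefMXn.
rewrite !mxE coefXnM; case: ifP => _; first by rewrite rmorph0 mxE.
by rewrite !coefC; case: eqP => // _; rewrite rmorph0 mxE.
Qed.

Lemma polymx_eval0 y : map_mx (horner_eval 0) (polymx y) = tau y`_0.
Proof.
by apply/matrixP => i j; rewrite mxE /horner_eval horner_coef0 coef_polymx.
Qed.

End PolyMatrix.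

Section Curve.
Variables (B : nzRingType) (E : fieldType) (n : nat).
Variable tau : {rmorphism B -> 'M[E]_n}.

(** The coefficients [p.1] lie in [E] and do not come from [B], but powers of [X] do. They are
    exchanged one at a time for powers of [X] that keep the determinant nonzero; positive exponents
    leave the constant term of [z] zero. *)
Lemma krylov_curve_step (u : 'rV[{poly E}]_n) (s : seq (E * B)) (M : 'M[{poly E}]_n) :
  \det (krylov u (M + \sum_(p <- s) p.1%:P *: map_mx polyC (tau p.2))) != 0 ->
  exists z : {poly B}, z`_0 = 0 /\ \det (krylov u (M + polymx tau z)) != 0.
Proof.
elim: s M => [|[c a] s IHs] M.
  rewrite big_nil addr0 => M0; exists 0; split; first exact: coef0.
  by rewrite -polyC0 polymxC rmorph0 map_mx0 addr0.
rewrite big_cons addrA addrAC => Mc.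
have [|k Mk] := krylov_avoid (t := 'X) _ Mc.
  by move=> i j /(congr1 (size \o polyseq)) /=; rewrite !size_polyXn => -[].
have [|z [z0 Mz]] := IHs (M + 'X^(k.+1) *: map_mx polyC (tau a)).
  by rewrite addrAC.
exists (z + a%:P * 'X^(k.+1)); split.
  by rewrite coefD z0 coefMXn addr0.
by rewrite polymxD polymxZXn addrA addrAC.
Qed.

Hypothesis tau_span : forall X, exists (k : nat) (c : 'I_k -> E) (x : 'I_k -> B),
  X = \sum_i c i *: tau (x i).

Lemma krylov_curve (h : B) : exists (y : {poly B}) (u : 'rV_n),
  y`_0 = h /\ \det (krylov u (polymx tau y)) != 0.
Proof.
(* The shift [N] has the identity as Krylov matrix at the first basis vector. Writing [N - tau h]
   over [E] and trading its coefficients for powers of [X] gives a curve through [h] with a cyclic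
   vector. *)
pose u : 'rV[E]_n := \row_j (nat_of_ord j == 0)%:R.
pose N : 'M[E]_n := \matrix_(i, j) (nat_of_ord j == i.+1)%:R.
have uN k : (k < n)%N -> u *m N ^+ k = \row_j (nat_of_ord j == k)%:R.
  elim: k => [|k IHk] kn; first by rewrite expr0 [LHS]mulmx1.
  rewrite exprSr mulmxA IHk 1?ltnW //; apply/rowP => j; rewrite !mxE.
  rewrite (bigD1 (Ordinal (ltnW kn))) //= !mxE eqxx mul1r big1 ?addr0 // => i ik.
  by rewrite -val_eqE /= in ik; rewrite !mxE (negPf ik) mul0r.
have uN1 : krylov u N = 1%:M.
  by apply/matrixP => k j; rewrite mxE uN // !mxE eq_sym.
have [q [c [x cx]]] := tau_span (N - tau h).
pose s := [seq (c i, x i) | i <- enum 'I_q].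
have [|z [z0 zP]] := @krylov_curve_step (map_mx polyC u) s (polymx tau h%:P).
  rewrite big_map big_enum /= polymxC.
  have -> : \sum_(i < q) (c i)%:P *: map_mx polyC (tau (x i)) = map_mx polyC (N - tau h).
    rewrite cx (raddf_sum (map_mx polyC)); apply: eq_bigr => i _.
    by apply/matrixP => a b; rewrite !mxE -polyCM.
  by rewrite -map_mxD addrC subrK -map_krylov uN1 map_mx1 det1 oner_neq0.
exists (h%:P + z), (map_mx polyC u); split; first by rewrite coefD z0 coefC addr0.
by rewrite polymxD.
Qed.

End Curve.

Lemma char_poly_relation (C : comNzRingType) n (M : 'M[C]_n) :
  \sum_(k < n.+1) (char_poly M)`_k *: M ^+ k = 0.
Proof.
case: n M => [|n] M; first by apply/matrixP => -[].
rewrite -[RHS](Cayley_Hamilton M) -[in RHS](coefK (char_poly M)) size_char_poly.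
rewrite poly_def linear_sum; apply: eq_bigr => k _.
by rewrite linearZ rmorphXn /= horner_mx_X.
Qed.

(** * Determinants from functionals with rational values *)

Section Functionals.
Variables (F : fieldType) (B : nzRingType) (I : finType) (gam : I -> B -> F).

(** The values [gam] on the image of [tau] are fixed before the representation, so that two
    representations over different fields can share them. *)
Definition rational_functionals (E : fieldType) (phi : {rmorphism F -> E}) (n : nat)
    (tau : {rmorphism B -> 'M[E]_n}) (ell : I -> 'M[E]_n -> E) : Prop :=
  [/\ forall s c X Y, ell s (c *: X + Y) = c * ell s X + ell s Y,
      forall s h, ell s (tau h) = phi (gam s h) &
      forall X, (forall s, ell s X = 0) -> X = 0].

Definition gam_poly (s : I) (z : {poly B}) : {poly F} :=
  \poly_(k < size z) gam s z`_k.

Section Datum.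
Variables (E : fieldType) (phi : {rmorphism F -> E}) (n : nat).
Variables (tau : {rmorphism B -> 'M[E]_n}) (ell : I -> 'M[E]_n -> E).
Hypothesis datum : rational_functionals phi tau ell.

Lemma ell0 s : ell s 0 = 0.
Proof.
have [lin _ _] := datum; have := lin s (-1) 0 0.
by rewrite scaler0 addr0 mulN1r addNr.
Qed.

Lemma ellZ s c X : ell s (c *: X) = c * ell s X.
Proof. by have [lin _ _] := datum; rewrite -[_ *: _]addr0 lin ell0 addr0. Qed.

Lemma ell_sum s (J : Type) (r : seq J) (X : J -> 'M[E]_n) :
  ell s (\sum_(j <- r) X j) = \sum_(j <- r) ell s (X j).
Proof.
have [lin _ _] := datum; apply: (big_morph (ell s)); last exact: ell0.
by move=> X' Y; rewrite -{1}[X']scale1r lin mul1r.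
Qed.

Lemma gam_poly_coef s z k : phi (gam_poly s z)`_k = phi (gam s z`_k).
Proof.
have [_ com _] := datum; rewrite coef_poly; case: ltnP => // zk.
by rewrite nth_default // -com !rmorph0 ell0.
Qed.

Lemma ell_poly s v z j :
  (v * map_poly phi (gam_poly s z))`_j =
  ell s (\matrix_(a, b) ((v *: polymx tau z) a b)`_j).
Proof.
have [_ com _] := datum.
transitivity (ell s (\sum_(i < j.+1) v`_i *: tau z`_(j - i))).
  rewrite ell_sum coefM; apply: eq_bigr => i _.
  by rewrite ellZ coef_map /= gam_poly_coef com.
have scE (M : 'M[{poly E}]_n) a b : (v *: M) a b = v * M a b by rewrite mxE.
congr (ell s _); apply/matrixP => a b; rewrite [RHS]mxE scE coefM summxE.
by apply: eq_bigr => i _; rewrite mxE coef_polymx.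
Qed.

(** Turns a relation between matrices over [E[X]] into scalar relations whose data [gam_poly] live
    over [F] and are common to all representations sharing [gam]. *)
Lemma poly_relation m (v : 'I_m -> {poly E}) (z : 'I_m -> {poly B}) :
  \sum_k v k *: polymx tau (z k) = 0 <->
  forall s, \sum_k v k * map_poly phi (gam_poly s (z k)) = 0.
Proof.
have [_ _ sep] := datum.
have E1 s j : (\sum_k v k * map_poly phi (gam_poly s (z k)))`_j =
    ell s (\matrix_(a, b) ((\sum_k v k *: polymx tau (z k)) a b)`_j).
  rewrite coef_sum; under eq_bigr => k _ do rewrite ell_poly.
  rewrite -ell_sum; congr (ell s _); apply/matrixP => a b.
  rewrite summxE mxE summxE coef_sum; apply: eq_bigr => k _; by rewrite mxE.
split=> [v0 s|v0].
  apply/polyP => j; rewrite E1 v0 coef0 -[RHS](ell0 s); congr (ell s _).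
  by apply/matrixP => a b; rewrite !mxE coef0.
apply/matrixP => a b; apply/polyP => j; rewrite mxE coef0.
have /matrixP/(_ a b) : \matrix_(a, b) ((\sum_k v k *: polymx tau (z k)) a b)`_j = 0.
  by apply: sep => s; rewrite -E1 v0 coef0.
by rewrite !mxE.
Qed.

End Datum.
End Functionals.

Section Core.
Variables (F : fieldType) (B : nzRingType) (I : finType) (gam : I -> B -> F).
Variables (E E' : fieldType) (phi : {rmorphism F -> E}) (phi' : {rmorphism F -> E'}).
Variables (n n' : nat) (tau : {rmorphism B -> 'M[E]_n}) (tau' : {rmorphism B -> 'M[E']_n'}).
Variables (ell : I -> 'M[E]_n -> E) (ell' : I -> 'M[E']_n' -> E').
Hypothesis datum : rational_functionals gam phi tau ell.
Hypothesis datum' : rational_functionals gam phi' tau' ell'.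
Hypothesis tau_span : forall X, exists (k : nat) (c : 'I_k -> E) (x : 'I_k -> B),
  X = \sum_i c i *: tau (x i).

Definition gam_mx (y : {poly B}) : 'M[{poly F}]_(n, #|I|) :=
  \matrix_(k, s) gam_poly gam (enum_val s) (y ^+ k).

(** A cyclic vector makes the first [n] powers of [polymx tau y] independent, hence also the rows of
    [gam_mx y] over [F[X]]. A right inverse exists over the fraction field, and [d] is a common
    denominator of it. *)
Lemma gam_mx_inverse (y : {poly B}) (u : 'rV_n) :
  \det (krylov u (polymx tau y)) != 0 ->
  exists (d : {poly F}) (C : 'M_(#|I|, n)), d != 0 /\ gam_mx y *m C = d%:M.
Proof.
move=> y0; set W := gam_mx y.
have W_inj (v : 'rV_n) : v *m W = 0 -> v = 0.
  move=> vW; suff : map_mx (map_poly phi) v = 0.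
    move=> /matrixP v0; apply/matrixP => i k; have := v0 i k; rewrite !mxE => /eqP.
    by rewrite map_poly_eq0 => /eqP.
  apply: krylov_free y0 _.
  under eq_bigr => k _ do rewrite -polymxX; apply/(poly_relation datum) => s.
  have /(congr1 (map_poly phi)) : (v *m W) 0 (enum_rank s) = 0 by rewrite vW mxE.
  rewrite rmorph0 mxE rmorph_sum => e; rewrite -[RHS]e; apply: eq_bigr => k _.
  by rewrite rmorphM !mxE enum_rankK.
have Wfree : row_free (map_mx (@tofrac _) W).
  apply: inj_row_free => v vW; have [d [v0 [d0 dv]]] := clear_denominators v.
  have v00 : v0 = 0.
    apply: W_inj; have : map_mx (@tofrac _) (v0 *m W) = 0.
      by rewrite map_mxM -dv -scalemxAl vW scaler0.
    move=> /matrixP v0W; apply/matrixP => i k; have := v0W i k; rewrite !mxE => /eqP.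
    by rewrite tofrac_eq0 => /eqP.
  move: dv; rewrite v00 map_mx0 => /eqP.
  by rewrite scaler_eq0 tofrac_eq0 (negPf d0) => /eqP.
have [d [C [d0 dC]]] := clear_denominators (pinvmx (map_mx (@tofrac _) W)).
exists d, C; split=> //; have := congr1 (mulmx (map_mx (@tofrac _) W)) dC.
rewrite -scalemxAr mulmxVp // -map_mxM => /matrixP WC.
apply/matrixP => i j; have := WC i j; rewrite !mxE mulr_natr -rmorphMn /= => /eqP.
by rewrite tofrac_eq => /eqP ->.
Qed.

(** If [n' < n], Cayley-Hamilton for [tau'] would be a monic relation among the rows of [gam_mx y],
    which the right inverse excludes. *)
Lemma core_size : (n <= n')%N.
Proof.
have [y [u [_ y0]]] := krylov_curve tau_span 0.
have [d [C [d0 WC]]] := gam_mx_inverse y0.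
rewrite leqNgt; apply/negP => n'n; set chi := char_poly (polymx tau' y).
pose v : 'rV_n := \row_k chi`_k.
have vW : v *m map_mx (map_poly phi') (gam_mx y) = 0.
  apply/rowP => s; rewrite !mxE.
  have := char_poly_relation (polymx tau' y).
  under eq_bigr => k _ do rewrite -polymxX.
  move/(poly_relation datum')/(_ (enum_val s)) => e; rewrite -[RHS]e.
  rewrite (big_ord_widen n (fun k => chi`_k * map_poly phi' (gam_poly gam (enum_val s) (y ^+ k)))) //.
  rewrite [RHS]big_mkcond /=; apply: eq_bigr => k _; rewrite !mxE; case: ltnP => // nk.
  by rewrite [chi`_k]nth_default ?mul0r // size_char_poly.
have : v *m map_mx (map_poly phi') (gam_mx y *m C) = 0 by rewrite map_mxM mulmxA vW mul0mx.
rewrite WC map_scalar_mx mul_mx_scalar => /matrixP/(_ 0 (Ordinal n'n)) /=.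
rewrite !mxE /=; have := char_poly_monic (polymx tau' y).
rewrite monicE lead_coefE size_char_poly /= => /eqP ->.
by rewrite mulr1 => /eqP; rewrite map_poly_eq0 (negPf d0).
Qed.

(** Both characteristic polynomials of the curve solve the same system over [F[X]], so [d] times
    either constant coefficient is the image of one [q]. Dividing by [d] and setting [X = 0] gives
    the determinants at [h]. *)
Lemma core_det (h : B) : n' = n ->
  exists d : F, \det (tau h) = phi d /\ \det (tau' h) = phi' d.
Proof.
(* The constant coefficient is entry 0 of a row of length [n], which exists only for positive
   [n]. *)
have [n0|n0] := posnP n.
  move=> n'n; have n'0 : n' = 0%N by rewrite n'n.
  exists 1; rewrite !rmorph1; split.
    by move: (tau h); rewrite n0 => M; apply: det_mx00.
  by move: (tau' h); rewrite n'0 => M; apply: det_mx00.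
move=> n'n; have [y [u [<- y0]]] := krylov_curve tau_span h.
have [d [C [d0 WC]]] := gam_mx_inverse y0.
pose w : 'rV_#|I| := \row_s gam_poly gam (enum_val s) (y ^+ n).
pose q := (- (w *m C)) 0 (Ordinal n0).
have key (E1 : fieldType) (phi1 : {rmorphism F -> E1}) n1 (tau1 : {rmorphism B -> 'M[E1]_n1}) ell1 :
    rational_functionals gam phi1 tau1 ell1 -> n1 = n ->
    (char_poly (polymx tau1 y))`_0 * map_poly phi1 d = map_poly phi1 q.
  move=> + n1n; move: tau1 ell1; rewrite n1n => tau1 ell1 dat; set chi := char_poly _.
  pose v : 'rV_n := \row_k chi`_k.
  have vW : v *m map_mx (map_poly phi1) (gam_mx y) = - map_mx (map_poly phi1) w.
    apply/rowP => s; rewrite !mxE.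
    have := char_poly_relation (polymx tau1 y).
    under eq_bigr => k _ do rewrite -polymxX.
    move/(poly_relation dat)/(_ (enum_val s)).
    rewrite big_ord_recr /= -/chi.
    have := char_poly_monic (polymx tau1 y).
    rewrite monicE lead_coefE size_char_poly /= => /eqP ->.
    rewrite mul1r => /eqP; rewrite addr_eq0 => /eqP e; rewrite -[RHS]e.
    by apply: eq_bigr => k _; rewrite !mxE.
  have : v *m map_mx (map_poly phi1) (gam_mx y *m C) = map_mx (map_poly phi1) (- (w *m C)).
    by rewrite map_mxM mulmxA vW mulNmx map_mxN map_mxM.
  rewrite WC map_scalar_mx mul_mx_scalar => /matrixP/(_ 0 (Ordinal n0)).
  by rewrite [LHS]mxE [RHS]mxE [v _ _]mxE /= mulrC.
have k1 := key _ _ _ _ _ datum erefl.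
(* Divisibility is visible over [E] and descends to [F] along the field morphism [phi]. *)
have /dvdpP [r qr] : d %| q.
  by rewrite -(dvdp_map phi) -k1 dvdp_mull.
have key2 (E1 : fieldType) (phi1 : {rmorphism F -> E1}) n1 (tau1 : {rmorphism B -> 'M[E1]_n1}) ell1 :
    rational_functionals gam phi1 tau1 ell1 -> n1 = n ->
    \det (tau1 y`_0) = phi1 ((-1) ^+ n * r.[0]).
  move=> + n1n; move: tau1 ell1; rewrite n1n => tau1 ell1 dat.
  have := key _ _ _ _ _ dat erefl; rewrite qr rmorphM /= => /mulIf.
  rewrite map_poly_eq0 => /(_ d0); rewrite char_poly_det.
  move/(congr1 ( *%R ((-1) ^+ n))); rewrite mulrA -expr2 sqrr_sign mul1r => dE.
  rewrite -polymx_eval0 det_map_mx dE /horner_eval.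
  rewrite /= /horner_eval hornerM horner_exp hornerN hornerC.
  by rewrite -[in X in _.[X]](rmorph0 phi1) horner_map rmorphM rmorphXn /= rmorphN1.
exists ((-1) ^+ n * r.[0]); split; first exact: key2 datum erefl.
exact: key2 datum' n'n.
Qed.

End Core.

(** * Determinants of block matrices *)

Lemma det_reindex (C : comPzRingType) (T : finType) (f : T -> T -> C) m n
    (e : 'I_m -> T) (e' : 'I_n -> T) : bijective e -> bijective e' ->
  \det (\matrix_(i, j) f (e i) (e j)) = \det (\matrix_(i, j) f (e' i) (e' j)).
Proof.
move=> eB e'B; have mn : m = n.
  by rewrite -[m]card_ord -[n]card_ord (bij_eq_card eB) (bij_eq_card e'B).
move: e eB; rewrite mn => e [g eK gK]; have [g' e'K g'K] := e'B.
have sP : injective (g' \o e) by apply: inj_comp; [exact: can_inj g'K|exact: can_inj eK].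
pose s := perm sP.
have -> : \matrix_(i, j) f (e i) (e j) = row_perm s (col_perm s (\matrix_(i, j) f (e' i) (e' j))).
  by apply/matrixP => i j; rewrite !mxE !permE /= !g'K.
rewrite row_permE col_permE !det_mulmx !det_perm odd_permV mulrC -mulrA.
by rewrite -signr_addb addbb mulr1.
Qed.

Section Flat.
Variables (B : pzRingType) (C : comNzRingType) (n : nat) (rho : B -> 'M[C]_n).

(* Indexing by pairs, rather than by [mxblock], turns the block identities below into
   reindexings of determinants. *)
Definition flat a b (H : 'M[B]_(a, b)) :
    'M[C]_(#|{: 'I_a * 'I_n}|, #|{: 'I_b * 'I_n}|) :=
  \matrix_(i, j) rho (H (enum_val i).1 (enum_val j).1) (enum_val i).2 (enum_val j).2.

Lemma flat_reindex a (H : 'M[B]_a) m (e : 'I_m -> 'I_a * 'I_n) : bijective e ->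
  \det (flat H) = \det (\matrix_(i, j) rho (H (e i).1 (e j).1) (e i).2 (e j).2).
Proof.
move=> eB; apply: (det_reindex (fun s t => rho (H s.1 t.1) s.2 t.2)) => //.
exact: enum_val_bij.
Qed.

Lemma det_mxblock a (H : 'M[B]_a) :
  \det (\mxblock_(i < a, j < a) rho (H i j)) = \det (flat H).
Proof.
pose e (s : 'I_(\sum_(i < a) n)) : 'I_a * 'I_n := (tagnat.sig1 s, tagnat.sig2 s).
have eB : bijective e.
  exists (fun t => tagnat.Rank t.1 t.2 : 'I_(\sum_(i < a) n)) => [s|[i k]].
    exact: tagnat.sig2K.
  rewrite /e /= tagnat.Rank1K; congr pair; apply: val_inj => /=.
  by rewrite tagnat.Rank2K.
by rewrite (flat_reindex H eB); congr (\det _).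
Qed.

Lemma det_flat_block a1 a2 (H1 : 'M[B]_a1) V W (H2 : 'M[B]_a2) :
  \det (flat (block_mx H1 V W H2)) =
  \det (block_mx (flat H1) (flat V) (flat W) (flat H2)).
Proof.
pose N1 := #|{: 'I_a1 * 'I_n}|; pose N2 := #|{: 'I_a2 * 'I_n}|.
pose e (s : 'I_(N1 + N2)) : 'I_(a1 + a2) * 'I_n :=
  match split s with
  | inl i => (lshift a2 (enum_val i).1, (enum_val i).2)
  | inr i => (rshift a1 (enum_val i).1, (enum_val i).2)
  end.
have sl m1 m2 (i : 'I_m1) : split (lshift m2 i) = inl i := unsplitK (inl i).
have sr m1 m2 (i : 'I_m2) : split (rshift m1 i) = inr i := unsplitK (inr i).
have eB : bijective e.
  exists (fun t => match split t.1 with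
    | inl i => lshift N2 (enum_rank (i, t.2))
    | inr i => rshift N1 (enum_rank (i, t.2))
    end).
    move=> s; rewrite /e; case: (split_ordP s) => i ->.
      by rewrite -[split _]/(split (lshift a2 (enum_val i).1)) sl /= -surjective_pairing enum_valK.
    by rewrite -[split _]/(split (rshift a1 (enum_val i).1)) sr /= -surjective_pairing enum_valK.
  case=> i k; rewrite [(i, k).1]/= [(i, k).2]/=.
  by case: (split_ordP i) => j ->; rewrite ?sl ?sr /e ?sl ?sr enum_rankK.
rewrite (flat_reindex _ eB); congr (\det _); apply/matrixP => i j; rewrite mxE /e.
case: (split_ordP i) => i' ->; case: (split_ordP j) => j' ->;
  rewrite ?sl ?sr.
- by rewrite !block_mxEul mxE.
- by rewrite !block_mxEur mxE.
- by rewrite !block_mxEdl mxE.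
- by rewrite !block_mxEdr mxE.
Qed.

Lemma flat0 a b : rho 0 = 0 -> flat (0 : 'M[B]_(a, b)) = 0.
Proof. by move=> rho0; apply/matrixP => i j; rewrite !mxE rho0 mxE. Qed.

Lemma det_flat_ublock a1 a2 (H1 : 'M[B]_a1) V (H2 : 'M[B]_a2) : rho 0 = 0 ->
  \det (flat (block_mx H1 V 0 H2)) = \det (flat H1) * \det (flat H2).
Proof. by move=> rho0; rewrite det_flat_block flat0 // det_ublock. Qed.

Lemma det_flat_lblock a1 a2 (H1 : 'M[B]_a1) V (H2 : 'M[B]_a2) : rho 0 = 0 ->
  \det (flat (block_mx H1 0 V H2)) = \det (flat H1) * \det (flat H2).
Proof. by move=> rho0; rewrite det_flat_block flat0 // det_lblock. Qed.

End Flat.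

Section FlatMorphism.
Variables (B : pzRingType) (C : comNzRingType) (n : nat) (rho : {rmorphism B -> 'M[C]_n}).

Lemma flatM a (H H' : 'M[B]_a) :
  flat rho (H *m H') = flat rho H *m flat rho H'.
Proof.
apply/matrixP => i j; rewrite [RHS]mxE (reindex _ (onW_bij _ (enum_rank_bij _))) /=.
transitivity (\sum_k \sum_l flat rho H i (enum_rank (k, l)) * flat rho H' (enum_rank (k, l)) j).
  rewrite !mxE rmorph_sum summxE; apply: eq_bigr => k _.
  by rewrite rmorphM mxE; apply: eq_bigr => l _; rewrite !mxE enum_rankK.
by rewrite pair_bigA; apply: eq_bigr => -[k l].
Qed.

Lemma flat1 a : flat rho (1%:M : 'M[B]_a) = 1%:M.
Proof.
apply/matrixP => i j; rewrite !mxE -(inj_eq enum_val_inj).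
case: (enum_val i) (enum_val j) => [k p] [l q] /=; rewrite xpair_eqE.
by case: (k == l); rewrite /= ?rmorph1 ?rmorph0 mxE.
Qed.

Lemma flatB a (H H' : 'M[B]_a) : flat rho (H - H') = flat rho H - flat rho H'.
Proof. by apply/matrixP => i j; rewrite !mxE rmorphB !mxE. Qed.

Lemma flat_rmorphism a : exists tau : {rmorphism 'M[B]_a -> 'M[C]_#|{: 'I_a * 'I_n}|},
  forall H, tau H = flat rho H.
Proof.
pose f (H : 'M[B]_a) := flat rho H.
pose tA := GRing.isZmodMorphism.Build _ _ f (@flatB a).
pose tM := GRing.isMonoidMorphism.Build _ _ f (conj (@flat1 a) (@flatM a)).
by exists (HB.pack_for {rmorphism 'M[B]_a -> 'M[C]_#|{: 'I_a * 'I_n}|} f tA tM).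
Qed.

End FlatMorphism.

(** * The reduced norm *)

Section SplittingSpan.
Variables (K : fieldType) (A : falgType K) (E : fieldType) (n : nat).
Variable rho : {rmorphism A -> 'M[E]_n.+1}.
Hypothesis spl : splitting rho.

Lemma scalar_center (k : K) : center (k *: (1 : A)).
Proof. by move=> y; rewrite -scalerAl -scalerAr mul1r mulr1. Qed.

(** [rho] is only a ring morphism, but scalars of [K] are central and hence go to scalar matrices,
    read off at entry [0 0]. *)
Lemma splittingZ (k : K) (a : A) : rho (k *: a) = rho (k *: (1 : A)) 0 0 *: rho a.
Proof.
rewrite -{1}[a]mul1r scalerAl rmorphM {1}(splitting_center spl (scalar_center k)).
exact: mul_scalar_mx.
Qed.

Lemma splitting_ext (L : 'M[E]_n.+1 -> E) :
  (forall c X Y, L (c *: X + Y) = c * L X + L Y) ->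
  (forall i : 'I_(\dim {:A}), L (rho (vbasis {:A})`_i) = 0) -> forall X, L X = 0.
Proof.
move=> lin L0 X.
have L00 : L 0 = 0 by have := lin (-1) 0 0; rewrite scaler0 addr0 mulN1r addNr.
have LZ c Y : L (c *: Y) = c * L Y by rewrite -[_ *: _]addr0 lin L00 addr0.
have LD Y Y' : L (Y + Y') = L Y + L Y' by rewrite -{1}[Y]scale1r lin mul1r.
have Lsum m (f : 'I_m -> 'M_n.+1) : L (\sum_i f i) = \sum_i L (f i) by apply: (big_morph L).
have [k [c [x ->]]] := spl X; rewrite Lsum big1 // => i _; rewrite LZ.
rewrite (coord_vbasis (memvf (x i))) rmorph_sum Lsum big1 ?mulr0 // => j _.
by rewrite splittingZ LZ L0 mulr0.
Qed.

Lemma flat_span a (X : 'M[E]_#|{: 'I_a * 'I_n.+1}|) :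
  exists (k : nat) (c : 'I_k -> E) (x : 'I_k -> 'M[A]_a), X = \sum_i c i *: flat rho (x i).
Proof.
pose blk (kl : 'I_a * 'I_a) : 'M[E]_n.+1 :=
  \matrix_(p, q) X (enum_rank (kl.1, p)) (enum_rank (kl.2, q)).
have [f fP] : {f : 'I_a * 'I_a -> {k : nat & (('I_k -> E) * ('I_k -> A))%type} &
    forall kl, blk kl = \sum_i (projT2 (f kl)).1 i *: rho ((projT2 (f kl)).2 i)}.
  apply: (choice (P := fun kl (t : {k : nat & (('I_k -> E) * ('I_k -> A))%type}) =>
     blk kl = \sum_i (projT2 t).1 i *: rho ((projT2 t).2 i))) => kl.
  by have [k [c [x e]]] := spl (blk kl); exists (existT _ k (c, x)).
pose J := {kl : 'I_a * 'I_a & 'I_(projT1 (f kl))}.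
have [k [c [x e]]] := span_over_fin (fun H : 'M[A]_a => flat rho H)
  (fun t : J => (projT2 (f (tag t))).1 (tagged t))
  (fun t : J => \matrix_(i, j) if (i, j) == tag t then (projT2 (f (tag t))).2 (tagged t) else 0).
exists k, c, x; rewrite -e; apply/matrixP => i j.
rewrite -(enum_valK i) -(enum_valK j); case: (enum_val i) (enum_val j) => [r p] [s q].
have -> : X (enum_rank (r, p)) (enum_rank (s, q)) = blk (r, s) p q by rewrite mxE.
rewrite fP summxE (summxE (index_enum J)).
pose F kl (i : 'I_(projT1 (f kl))) := ((projT2 (f kl)).1 i *: flat rho
  (\matrix_(i', j) if (i', j) == kl then (projT2 (f kl)).2 i else 0))
  (enum_rank (r, p)) (enum_rank (s, q)).
rewrite -(sig_big_dep xpredT (fun _ => xpredT) F) (bigD1 (r, s)) //=.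
rewrite [X in _ = _ + X]big1 ?addr0 => [|kl rs].
  by apply: eq_bigr => i' _; rewrite /F !mxE !enum_rankK /= eqxx.
rewrite big1 // => i' _; rewrite /F !mxE !enum_rankK /= eq_sym (negPf rs).
by rewrite rmorph0 mxE mulr0.
Qed.

End SplittingSpan.

Section SplittingFunctionals.
Variables (K : fieldType) (A : falgType K) (k : nat) (x y : 'I_k -> A).
Hypothesis xy1 : \sum_i x i * y i = 1.
Hypothesis cas : forall (a : A) (B : {biscalar A}),
  \sum_i B (a * x i) (y i) = \sum_i B (x i) (y i * a).
Variables (E : fieldType) (n : nat) (rho : {rmorphism A -> 'M[E]_n.+1}).
Hypothesis spl : splitting rho.
Variable a : nat.

Notation b := (vbasis {:A}).
Notation idx := ('I_(\dim {:A}) * 'I_(\dim {:A}) * ('I_a * 'I_a))%type.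

Definition casimir_fun (Y : 'M[E]_n.+1) : E :=
  \sum_i (rho (x i) *m Y *m rho (y i)) 0 0.

Definition block_of (X : 'M[E]_#|{: 'I_a * 'I_n.+1}|) (kl : 'I_a * 'I_a) : 'M[E]_n.+1 :=
  \matrix_(p, q) X (enum_rank (kl.1, p)) (enum_rank (kl.2, q)).

Definition block_functional (s : idx) (X : 'M[E]_#|{: 'I_a * 'I_n.+1}|) : E :=
  casimir_fun (rho b`_s.1.1 *m block_of X s.2 *m rho b`_s.1.2).

(** A central element of [A] that does not involve [rho]: a splitting sends it to the scalar that
    [block_functional] takes on the image of [H]. This is why the functionals have rational
    values. *)
Definition block_coef (s : idx) (H : 'M[A]_a) : A :=
  \sum_i x i * (b`_s.1.1 * H s.2.1 s.2.2 * b`_s.1.2) * y i.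

Lemma casimir_fun_linear c X Y :
  casimir_fun (c *: X + Y) = c * casimir_fun X + casimir_fun Y.
Proof.
rewrite /casimir_fun mulr_sumr -big_split; apply: eq_bigr => i _ /=.
by rewrite mulmxDr mulmxDl -scalemxAr -scalemxAl !mxE.
Qed.

Lemma casimir_fun0 : casimir_fun 0 = 0.
Proof. by rewrite /casimir_fun big1 // => i _; rewrite mulmx0 mul0mx mxE. Qed.

(** Since the image of [rho] spans, the vanishing extends to all [M *m Y *m M']. A nonzero entry of
    [Y] would yield every diagonal matrix unit, hence the identity, where [casimir_fun] is 1. *)
Lemma casimir_fun_sandwich (Y : 'M[E]_n.+1) :
  (forall i j : 'I_(\dim {:A}), casimir_fun (rho b`_i *m Y *m rho b`_j) = 0) -> Y = 0.
Proof.
move=> Y0; have Y1 M (j : 'I_(\dim {:A})) : casimir_fun (M *m Y *m rho b`_j) = 0.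
  move: M; apply: (splitting_ext spl (L := fun M => casimir_fun (M *m Y *m rho b`_j))) => //.
  by move=> c X Z; rewrite !mulmxDl -!scalemxAl casimir_fun_linear.
have Y2 M M' : casimir_fun (M *m Y *m M') = 0.
  move: M'; apply: (splitting_ext spl (L := fun M' => casimir_fun (M *m Y *m M'))) => //.
  by move=> c X Z; rewrite !mulmxDr -!scalemxAr casimir_fun_linear.
have lam1 : casimir_fun 1%:M = 1.
  transitivity (rho (\sum_i x i * y i) 0 0); last by rewrite xy1 rmorph1 mxE eqxx.
  rewrite rmorph_sum summxE; apply: eq_bigr => i _.
  by rewrite rmorphM mulmx1.
apply/matrixP => p q; rewrite mxE; apply/eqP; apply: contraT => Ypq.
have : casimir_fun 1%:M = 0.
  rewrite mx1_sum_delta.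
  have lamS m (f : 'I_m -> 'M[E]_n.+1) : casimir_fun (\sum_i f i) = \sum_i casimir_fun (f i).
    apply: (big_morph casimir_fun); last exact: casimir_fun0.
    by move=> X Z; rewrite -{1}[X]scale1r casimir_fun_linear mul1r.
  rewrite lamS big1 // => r _; apply: (mulfI Ypq); rewrite mulr0.
  have lamZ c X : casimir_fun (c *: X) = c * casimir_fun X.
    by rewrite -[_ *: X]addr0 casimir_fun_linear casimir_fun0 addr0.
  rewrite -lamZ; have -> : Y p q *: delta_mx r r = delta_mx r p *m Y *m delta_mx q r.
    rewrite -[delta_mx r p](mul_delta_mx (0 : 'I_1)) -[delta_mx q r](mul_delta_mx (0 : 'I_1)).
    rewrite -[delta_mx r r](mul_delta_mx (0 : 'I_1)) -!mulmxA scalemxAr; congr (_ *m _).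
    rewrite !mulmxA -rowE -colE [col _ _]mx11_scalar mul_scalar_mx; congr (_ *: _).
    by rewrite !mxE.
  exact: Y2.
by rewrite lam1 => /eqP; rewrite oner_eq0.
Qed.

Lemma block_functionals (F : fieldType) (phi : {rmorphism F -> E})
    (tau : {rmorphism 'M[A]_a -> 'M[E]_#|{: 'I_a * 'I_n.+1}|})
    (gam : idx -> 'M[A]_a -> F) :
  (forall H, tau H = flat rho H) ->
  (forall s H, phi (gam s H) = rho (block_coef s H) 0 0) ->
  [/\ forall s c X Y, block_functional s (c *: X + Y) = c * block_functional s X + block_functional s Y,
      forall s h, block_functional s (tau h) = phi (gam s h) &
      forall X, (forall s, block_functional s X = 0) -> X = 0].
Proof.
move=> tauE gamE; split.
- move=> s c X Y; rewrite /block_functional -casimir_fun_linear; congr casimir_fun.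
  have -> : block_of (c *: X + Y) s.2 = c *: block_of X s.2 + block_of Y s.2.
    by apply/matrixP => p q; rewrite !mxE.
  by rewrite mulmxDr mulmxDl -scalemxAr -scalemxAl.
- move=> s H; rewrite gamE rmorph_sum summxE; apply: eq_bigr => i _.
  have -> : block_of (tau H) s.2 = rho (H s.2.1 s.2.2).
    by apply/matrixP => p q; rewrite tauE !mxE !enum_rankK.
  by rewrite !rmorphM.
- move=> X X0; apply/matrixP => i j; rewrite mxE.
  rewrite -(enum_valK i) -(enum_valK j); case: (enum_val i) (enum_val j) => [r p] [s q].
  have /matrixP/(_ p q) : block_of X (r, s) = 0; last by rewrite !mxE.
  by apply: casimir_fun_sandwich => i' j'; have := X0 (i', j', (r, s)).
Qed.

End SplittingFunctionals.

Section Pair.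
Variables (K : fieldType) (A : falgType K).
Hypothesis sepA : separable_algebra A.
Variables (E : fieldType) (n : nat) (rho : {rmorphism A -> 'M[E]_n.+1}).
Variables (E' : fieldType) (n' : nat) (rho' : {rmorphism A -> 'M[E']_n'.+1}).
Hypotheses (spl : splitting rho) (spl' : splitting rho').
Variable e : A.
Hypothesis eK : forall z, center z -> rho z = 0 -> z * e = 0.
Hypothesis e' : rho' e = 1.

Let rhoE z : center z -> rho z = (rho z 0 0)%:M := splitting_center spl.
Let rhoE' z : center z -> rho' z = (rho' z 0 0)%:M := splitting_center spl'.

Let rho0 z : center z -> rho z 0 0 = 0 -> rho' z = 0.
Proof.
move=> zC z0; have ze : z * e = 0 by apply: eK => //; rewrite rhoE // z0 raddf0.
by have := congr1 rho' ze; rewrite rmorphM e' mulr1 rmorph0.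
Qed.

Let rhoM00 (E1 : fieldType) n1 (rho1 : {rmorphism A -> 'M[E1]_n1.+1}) z w : splitting rho1 ->
  center z -> center w -> rho1 (z * w) 0 0 = rho1 z 0 0 * rho1 w 0 0.
Proof.
move=> spl1 zC wC; rewrite rmorphM (splitting_center spl1 zC) (splitting_center spl1 wC).
by rewrite -[_ * _]/(_ *m _) -scalar_mxM !mxE eqxx !mulr1n.
Qed.

(** [F] is the image of the center in [E], a field by [center_regular]. A central element killed by
    [rho] is annihilated by [e], hence killed by [rho']; so [F] maps to [E'] as well. *)
Lemma center_fields : exists (F : fieldType) (phi : {rmorphism F -> E})
    (phi' : {rmorphism F -> E'}) (prj : A -> F),
  (forall z, center z -> phi (prj z) = rho z 0 0 /\ phi' (prj z) = rho' z 0 0) /\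
  forall d, exists2 z, center z & d = prj z.
Proof.
pose P t := exists2 z, center z & rho z 0 0 = t.
have P1 : P 1 by exists 1; [exact: center1|rewrite rmorph1 mxE eqxx].
have PB t t' : P t -> P t' -> P (t - t').
  move=> [z zC <-] [w wC <-]; exists (z - w); first exact: centerB.
  by rewrite rmorphB !mxE.
have PM t t' : P t -> P t' -> P (t * t').
  move=> [z zC <-] [w wC <-]; exists (z * w); first exact: centerM.
  exact: rhoM00.
have PV t : P t -> P t^-1.
  move=> [z zC <-]; have [u uC zE] := center_regular sepA zC.
  have [z0|z0] := eqVneq (rho z 0 0) 0; first by rewrite z0 invr0; exists z.
  exists u => //; apply: (mulIf z0); rewrite mulVf //.
  apply: (mulIf z0); rewrite mul1r -rhoM00 // -rhoM00 //; last exact: centerM.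
  by rewrite -zE.
have [F [phi phiP]] := subfield_ext P1 PB PM PV.
pose G t t' := exists z, [/\ center z, rho z 0 0 = phi t & rho' z 0 0 = t'].
have Gtot t : exists t', G t t'.
  have [z zC ze] : P (phi t) by apply/phiP; exists t.
  by exists (rho' z 0 0), z.
have Gfun t t1 t2 : G t t1 -> G t t2 -> t1 = t2.
  move=> [z [zC z1 <-]] [w [wC w1 <-]]; apply/eqP; rewrite -subr_eq0.
  have : rho' (z - w) = 0 by apply: rho0; [exact: centerB|rewrite rmorphB !mxE z1 w1 subrr].
  by rewrite rmorphB => /matrixP/(_ 0 0); rewrite !mxE => ->.
have [||| phi' phi'P] := rmorph_of_rel Gtot Gfun.
- by exists 1; split; [exact: center1|rewrite !rmorph1 mxE eqxx|rewrite rmorph1 mxE eqxx].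
- move=> t t1 s s1 [z [zC z1 <-]] [w [wC w1 <-]]; exists (z - w).
  by split; [exact: centerB|rewrite !rmorphB !mxE z1 w1|rewrite rmorphB !mxE].
- move=> t t1 s s1 [z [zC z1 <-]] [w [wC w1 <-]]; exists (z * w).
  by split; [exact: centerM|rewrite rhoM00 // z1 w1 rmorphM|rewrite rhoM00].
have [prj piP] : {prj : A -> F & forall z, center z -> phi (prj z) = rho z 0 0}.
  apply: (choice (P := fun z t => center z -> phi t = rho z 0 0)) => z.
  have [zC|nzC] := pselect (center z); last by exists 0.
  have [t te] : exists t, phi t = rho z 0 0 by apply/phiP; exists z.
  by exists t.
exists F, phi, phi', prj; split=> [z zC|d].
  by split; [exact: piP|apply: phi'P; exists z; rewrite piP].
have [z zC ze] : P (phi d) by apply/phiP; exists d.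
by exists z => //; apply: (fmorph_inj phi); rewrite piP.
Qed.

(** The elements [block_coef] give rational functionals for both splittings with the same [gam]; the
    sizes agree by symmetry of [core_size], and [core_det] applies. *)
Lemma det_center_pair a (H : 'M[A]_a) : exists z, [/\ center z,
  rho z = (\det (flat rho H))%:M & rho' z = (\det (flat rho' H))%:M].
Proof.
(* Matrices of size 0 form the zero ring, which is excluded as a source of representations; both
   determinants are 1. *)
case: a H => [|a] H.
  have det0 (E1 : fieldType) n1 (rho1 : {rmorphism A -> 'M[E1]_n1.+1}) : \det (flat rho1 H) = 1.
    have c0 : #|{: 'I_0 * 'I_n1.+1}| = 0%N by rewrite card_prod card_ord.
    by move: (flat rho1 H); rewrite c0 => M; apply: det_mx00.
  by exists 1; split; rewrite ?det0 ?rmorph1 //; exact: center1.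
have [k [x [y [xy1 cas]]]] := sepA.
have [cC _] := center_proj xy1 cas.
have [F [phi [phi' [prj [prjP prj_surj]]]]] := center_fields.
pose gam s (M : 'M[A]_a.+1) := prj (block_coef x y s M).
have [tau tauE] := flat_rmorphism rho a.+1.
have [tau' tauE'] := flat_rmorphism rho' a.+1.
have dat := block_functionals xy1 spl (phi := phi) (gam := gam) tauE (fun s M => (prjP _ (cC _)).1).
have dat' := block_functionals xy1 spl' (phi := phi') (gam := gam) tauE' (fun s M => (prjP _ (cC _)).2).
have span X : exists (m : nat) (c : 'I_m -> E) (h : 'I_m -> 'M[A]_a.+1), X = \sum_i c i *: tau (h i).
  have [m [c [h ->]]] := flat_span spl X; exists m, c, h.
  by apply: eq_bigr => i _; rewrite tauE.
have span' X : exists (m : nat) (c : 'I_m -> E') (h : 'I_m -> 'M[A]_a.+1), X = \sum_i c i *: tau' (h i).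
  have [m [c [h ->]]] := flat_span spl' X; exists m, c, h.
  by apply: eq_bigr => i _; rewrite tauE'.
have NN : #|{: 'I_a.+1 * 'I_n'.+1}| = #|{: 'I_a.+1 * 'I_n.+1}|.
  by apply/eqP; rewrite eqn_leq (core_size dat dat' span) (core_size dat' dat span').
have [d [det1 det2]] := core_det dat dat' span H NN.
have [z zC dz] := prj_surj d; exists z; split=> //.
  by rewrite -tauE det1 dz (prjP _ zC).1 -rhoE.
by rewrite -tauE' det2 dz (prjP _ zC).2 -rhoE'.
Qed.

End Pair.

Section ReducedNorm.
Variables (K : fieldType) (A : falgType K).
Hypothesis sepA : separable_algebra A.

Lemma ideal_dim_center_ind (P : A -> Prop) : P 0 ->
  (forall g, center g -> g * g = g -> g != 0 ->
     (forall g', center g' -> g' * g' = g' -> (ideal_dim g' < ideal_dim g)%N -> P g') -> P g) ->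
  forall g, center g -> g * g = g -> P g.
Proof.
move=> P0 PS g; have [m] := ubnP (ideal_dim g); elim: m g => // m IHm g gm gC gg.
have [->//|g0] := eqVneq g 0; apply: PS => // g' g'C gg' lt.
by apply: IHm => //; apply: leq_trans lt _.
Qed.

(* Choose a splitting [rho] with [rho g = 1]; its component [e] can be taken
   inside [g], and [g - e] is again a central idempotent. *)
Lemma component_in (g : A) : center g -> g * g = g -> g != 0 ->
  exists (E : fieldType) (n : nat) (rho : {rmorphism A -> 'M[E]_n.+1}) (e : A),
    [/\ splitting rho, rho e = 1, center e /\ e * e = e,
        forall z, center z -> rho z = 0 -> z * e = 0 &
        [/\ e * g = e, center (g - e), (g - e) * (g - e) = g - e &
            (ideal_dim (g - e)%R < ideal_dim g)%N]].
Proof.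
move=> gC gg g0; have [E [n [rho [spl rg]]]] := splitting_exists sepA gC gg g0.
have [e [eC ee re eK]] := component sepA rho.
have fC : center (e * g) by apply: centerM.
have ff : e * g * (e * g) = e * g by rewrite mulrA -(mulrA e g) (gC e) mulrA ee -mulrA gg.
have fg : e * g * g = e * g by rewrite -mulrA gg.
have rf : rho (e * g) = 1 by rewrite rmorphM re rg mulr1.
exists E, n, rho, (e * g); split=> //.
  by move=> z zC rz; rewrite mulrA eK // mul0r.
split=> //; first exact: centerB.
  by rewrite mulrBl !mulrBr ff fg gg (gC (e * g)) fg subrr subr0.
apply: ideal_dim_lt => //; apply: contra_eq_neq rf => ->.
by rewrite rmorph0 eq_sym oner_neq0.
Qed.

(** Induction on central idempotents. One splitting of the component [e] provides [z0]; comparing it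
    with any other splitting that sends [e] to 1 shows that [z0] serves all of them. As [e] goes to
    0 or 1 in each splitting, the values glue. *)
Lemma reduced_norm_exists a (H : 'M[A]_a) : exists z, is_reduced_norm H z.
Proof.
suff : exists2 z, center z & forall (E : fieldType) n (rho : {rmorphism A -> 'M[E]_n.+1}),
    splitting rho -> rho 1 = 1 -> rho z = (\det (flat rho H))%:M.
  move=> [z zC zP]; exists z; split; first exact/centerE.
  by move=> E n rho spl; rewrite det_mxblock zP ?rmorph1.
move: (1 : A) (@center1 A) (mulr1 (1 : A)); apply: ideal_dim_center_ind.
  exists 0; first exact: center0.
  by move=> E n rho _ /eqP; rewrite rmorph0 eq_sym oner_eq0.
move=> g gC gg g0 IH.
have [E0 [n0 [rho0 [e [spl0 re0 [eC ee] eK [eg geC gege lt]]]]]] := component_in gC gg g0.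
have [z' z'C z'P] := IH _ geC gege lt.
have [z0 [z0C rz0 _]] := det_center_pair sepA spl0 spl0 eK re0 H.
have z0P (E : fieldType) n (rho : {rmorphism A -> 'M[E]_n.+1}) :
    splitting rho -> rho e = 1 -> rho z0 = (\det (flat rho H))%:M.
  move=> spl re; have [z [zC rz0' rz]] := det_center_pair sepA spl0 spl eK re H.
  rewrite -rz; apply/eqP; rewrite -subr_eq0 -rmorphB.
  have dC : center (z0 - z) by apply: centerB.
  have /(congr1 rho) : (z0 - z) * e = 0 by apply: eK; rewrite // rmorphB rz0 rz0' subrr.
  by rewrite rmorphM re mulr1 rmorph0 => ->.
exists (z' * (g - e) + z0 * e).
  by apply: centerD; apply: centerM.
move=> E n rho spl rg; rewrite rmorphD !rmorphM rmorphB rg.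
have [re|re] := splitting_center_idem spl eC ee; rewrite re.
  by rewrite subr0 mulr0 addr0 mulr1 z'P // rmorphB rg re subr0.
by rewrite subrr mulr0 add0r mulr1 z0P.
Qed.

Lemma reduced_norm_unique a (H : 'M[A]_a) z w :
  is_reduced_norm H z -> is_reduced_norm H w -> z = w.
Proof.
move=> [/centerE zC zP] [/centerE wC wP]; apply: (center_sep sepA) => // E n rho spl.
by rewrite zP // wP.
Qed.

Lemma NrdP a (H : 'M[A]_a) : is_reduced_norm H (Nrd H).
Proof. by rewrite /Nrd; case: xgetP => // /(_ _ _) nz; have [z /nz] := reduced_norm_exists H. Qed.

Lemma Nrd_center a (H : 'M[A]_a) : center (Nrd H).
Proof. by have [/centerE] := NrdP H. Qed.

Lemma Nrd_split a (H : 'M[A]_a) (E : fieldType) n (rho : {rmorphism A -> 'M[E]_n.+1}) :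
  splitting rho -> rho (Nrd H) = (\det (flat rho H))%:M.
Proof. by move=> spl; have [_ /(_ _ _ _ spl) ->] := NrdP H; rewrite det_mxblock. Qed.

Lemma Nrd_eq a (H : 'M[A]_a) z : center z ->
  (forall (E : fieldType) n (rho : {rmorphism A -> 'M[E]_n.+1}),
    splitting rho -> rho z = (\det (flat rho H))%:M) -> Nrd H = z.
Proof.
move=> zC zP; apply: (reduced_norm_unique (NrdP H)); split; first exact/centerE.
by move=> E n rho spl; rewrite det_mxblock zP.
Qed.

Lemma NrdM a (H H' : 'M[A]_a) : Nrd (H *m H') = Nrd H * Nrd H'.
Proof.
apply: Nrd_eq; first by apply: centerM; apply: Nrd_center.
move=> E n rho spl; rewrite rmorphM !Nrd_split // flatM det_mulmx scalar_mxM.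
by [].
Qed.

Lemma Nrd1 a : Nrd (1%:M : 'M[A]_a) = 1.
Proof.
apply: Nrd_eq; first exact: center1.
by move=> E n rho spl; rewrite flat1 det1 rmorph1.
Qed.

Lemma Nrd_ublock a1 a2 (H1 : 'M[A]_a1) V (H2 : 'M[A]_a2) :
  Nrd (block_mx H1 V 0 H2) = Nrd H1 * Nrd H2.
Proof.
apply: Nrd_eq; first by apply: centerM; apply: Nrd_center.
move=> E n rho spl; rewrite rmorphM !Nrd_split // det_flat_ublock ?rmorph0 //.
by rewrite scalar_mxM.
Qed.

Lemma Nrd_lblock a1 a2 (H1 : 'M[A]_a1) V (H2 : 'M[A]_a2) :
  Nrd (block_mx H1 0 V H2) = Nrd H1 * Nrd H2.
Proof.
apply: Nrd_eq; first by apply: centerM; apply: Nrd_center.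
move=> E n rho spl; rewrite rmorphM !Nrd_split // det_flat_lblock ?rmorph0 //.
by rewrite scalar_mxM.
Qed.

End ReducedNorm.

(** * Submodules and noetherian rings *)

Section Span.
Variable T : nzRingType.
Implicit Types (C X G : set T).

Lemma span_submodule C G : submodule C (span C G).
Proof.
split=> [X [[X0 _ _] _]|x y xG yG X XG|c x Cc xG X XG] //.
  by have [[_ XD _] _] := XG; apply: XD; [apply: xG|apply: yG].
by have [[_ _ XM] _] := XG; apply: XM => //; apply: xG.
Qed.

Lemma span_gen C G x : G x -> span C G x.
Proof. by move=> Gx X [_ GX]; apply: GX. Qed.

Lemma span_min C G X : submodule C X -> G `<=` X -> span C G `<=` X.
Proof. by move=> XC GX x; apply; split. Qed.

Lemma submodule_sum C X : submodule C X -> forall n (f : 'I_n -> T),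
  (forall i, X (f i)) -> X (\sum_i f i).
Proof.
move=> [X0 XD _] n f Xf.
by elim/big_ind: _ => // i _.
Qed.

Lemma span_id C X : submodule C X -> span C X = X.
Proof.
by move=> XC; apply/seteqP; split; [apply: span_min|move=> x; apply: span_gen].
Qed.

Lemma span_mono C G G' : G `<=` G' -> span C G `<=` span C G'.
Proof.
by move=> GG'; apply: span_min (span_submodule _ _) _ => x /GG' /span_gen.
Qed.

Definition is_subring C : Prop :=
  [/\ C 0, C 1, forall x y, C x -> C y -> C (x + y) &
      forall x y, C x -> C y -> C (x * y)].

Lemma span_finP C (n : nat) (x : 'I_n -> T) z : is_subring C ->
  span C (range x) z <-> exists c : 'I_n -> T, (forall i, C (c i)) /\ z = \sum_i c i * x i.
Proof.
move=> [C0 C1 CD CM]; split; last first.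
  move=> [c [Cc ->]]; apply: (submodule_sum (span_submodule _ _)) => i.
  have [_ _ SM] := span_submodule C (range x); apply: SM => //.
  by apply: span_gen; exists i.
apply: (@span_min C _ (fun z => exists c : 'I_n -> T, (forall i, C (c i)) /\ z = \sum_i c i * x i)).
  split.
  - by exists (fun=> 0); split=> //; rewrite big1 // => i _; rewrite mul0r.
  - move=> _ _ [c [Cc ->]] [d [Cd ->]]; exists (fun i => c i + d i); split=> [i|]; first exact: CD.
    by rewrite -big_split; apply: eq_bigr => i _; rewrite mulrDl.
  - move=> a _ Ca [c [Cc ->]]; exists (fun i => a * c i); split=> [i|]; first exact: CM.
    by rewrite mulr_sumr; apply: eq_bigr => i _; rewrite mulrA.
move=> _ [i _ <-]; exists (fun j => (j == i)%:R); split=> [j|]; first by case: (j == i).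
rewrite (bigD1 i) //= eqxx mul1r big1 ?addr0 // => j /negPf ->.
by rewrite mul0r.
Qed.

End Span.

Section Noetherian.
Variable L : comNzRingType.
Hypothesis noethL : noetherian L.

(** The first coordinates form a finitely generated ideal; subtracting lifts of its generators
    leaves vectors with first coordinate 0, that is shorter rows padded by [P]. *)
Lemma noetherian_rows k (N : 'rV[L]_k -> Prop) :
  N 0 -> (forall u v, N u -> N v -> N (u + v)) -> (forall c u, N u -> N (c *: u)) ->
  exists m (G : 'I_m -> 'rV_k), (forall i, N (G i)) /\
    forall v, N v -> exists c : 'I_m -> L, v = \sum_i c i *: G i.
Proof.
elim: k N => [|k IHk] N N0 ND NZ.
  by exists 0%N, (fun=> 0); split=> // v _; exists (fun=> 0); rewrite big_ord0 thinmx0.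
have idI : ideal [set v 0 0 | v in N].
  split.
  - by exists 0 => //; rewrite mxE.
  - by move=> _ _ [u Nu <-] [v Nv <-]; exists (u + v); [apply: ND|rewrite mxE].
  - by move=> c _ _ [u Nu <-]; exists (c *: u); [apply: NZ|rewrite mxE].
have [m [x xE]] := noethL idI.
have xN i : [set v 0 0 | v in N] (x i) by rewrite xE; apply: span_gen; exists i.
have [u uP] : {u : 'I_m -> 'rV_k.+1 & forall i, N (u i) /\ u i 0 0 = x i}.
  by apply: (choice (P := fun i v => N v /\ v 0 0 = x i)) => i; have [v] := xN i; exists v.
pose P : 'M[L]_(k, k.+1) := row_mx (0 : 'M_(k, 1)) (1%:M : 'M_k).
have [||| m' [G [GN GP]]] := IHk (fun w => N (w *m P)).
- by rewrite mul0mx.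
- by move=> w w' Nw Nw'; rewrite mulmxDl; apply: ND.
- by move=> c w Nw; rewrite -scalemxAl; apply: NZ.
have Nsum n (f : 'I_n -> 'rV_k.+1) : (forall i, N (f i)) -> N (\sum_i f i).
  by move=> Nf; elim/big_ind: _.
pose H (s : 'I_(m + m')) : 'rV_k.+1 := match split s with
  inl i => u i | inr j => G j *m P end.
exists (m + m')%N, H; split.
  by move=> s; rewrite /H; case: (split s) => [i|j]; [have [] := uP i|apply: GN].
move=> v Nv; have : [set v 0 0 | v in N] (v 0 0) by exists v.
rewrite xE => /span_finP [//|c [_ cE]].
pose w := v - \sum_i c i *: u i.
have Nw : N w.
  apply: ND => //; rewrite -scaleN1r; apply: (NZ); apply: Nsum => i.
  by apply: NZ; have [] := uP i.
have w0 : w = (rsubmx (w : 'rV_(1 + k))) *m P.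
  apply: (@etrans _ _ (row_mx (0 : 'M_1) (rsubmx (w : 'rV_(1 + k))))); last first.
    apply/esym; have := mul_mx_row (rsubmx (w : 'rV_(1 + k))) (0 : 'M_(k, 1)) (1%:M : 'M_k).
    by rewrite mulmx0 mulmx1.
  rewrite -[LHS](hsubmxK (w : 'rV_(1 + k))); congr row_mx.
  apply/matrixP => i j; rewrite !ord1 mxE.
  have -> : lshift k (0 : 'I_1) = 0 :> 'I_k.+1 by apply: val_inj.
  rewrite /w !mxE summxE cE; apply/eqP; rewrite subr_eq0; apply/eqP.
  by apply: eq_bigr => l _; rewrite mxE; have [_ ->] := uP l.
have [d dE] := GP _ (eq_ind _ N Nw _ w0).
exists (fun s => match split s with inl i => c i | inr j => d j end).
rewrite big_split_ord /=.
under eq_bigr => i _ do rewrite /H (unsplitK (inl i)).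
under [X in _ + X]eq_bigr => i _ do rewrite /H (unsplitK (inr i)).
apply/eqP; rewrite addrC -subr_eq -/w w0 dE mulmx_suml; apply/eqP.
by apply: eq_bigr => i _; rewrite scalemxAl.
Qed.

(** The action is a bare function so that [L] can act on a field through a morphism as well as on
    rows over [R] through the algebra structure. *)
Lemma noetherian_action (U : zmodType) (act : L -> U -> U) k (g : 'I_k -> U)
    (J : U -> Prop) :
  (forall c d u, act (c + d) u = act c u + act d u) ->
  (forall c u v, act c (u + v) = act c u + act c v) ->
  (forall c d u, act (c * d) u = act c (act d u)) ->
  J 0 -> (forall u v, J u -> J v -> J (u + v)) -> (forall c u, J u -> J (act c u)) ->
  (forall u, J u -> exists c : 'I_k -> L, u = \sum_i act (c i) (g i)) ->
  exists m (G : 'I_m -> U), (forall i, J (G i)) /\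
    forall u, J u -> exists c : 'I_m -> L, u = \sum_i act (c i) (G i).
Proof.
move=> actDl actDr actM J0 JD JZ JP.
have act0l u : act 0 u = 0 by apply: (addrI (act 0 u)); rewrite -actDl !addr0.
have act0r c : act c 0 = 0 by apply: (addrI (act c 0)); rewrite -actDr !addr0.
have act_suml (I : Type) (r : seq I) (f : I -> L) u :
    act (\sum_(i <- r) f i) u = \sum_(i <- r) act (f i) u.
  by apply: (big_morph (act^~ u)).
have act_sumr (I : Type) (r : seq I) (f : I -> U) c :
    act c (\sum_(i <- r) f i) = \sum_(i <- r) act c (f i).
  exact: (big_morph (act c)).
pose ev (v : 'rV[L]_k) := \sum_i act (v 0 i) (g i).
have evD u v : ev (u + v) = ev u + ev v.
  by rewrite -big_split; apply: eq_bigr => i _; rewrite mxE actDl.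
have evZ c v : ev (c *: v) = act c (ev v).
  by rewrite act_sumr; apply: eq_bigr => i _; rewrite mxE actM.
have ev0 : ev 0 = 0 by rewrite /ev big1 // => i _; rewrite mxE.
have [||| m [G [GJ GP]]] := @noetherian_rows k (fun v => J (ev v)).
- by rewrite ev0.
- by move=> u v Ju Jv; rewrite evD; apply: JD.
- by move=> c u Ju; rewrite evZ; apply: JZ.
exists m, (ev \o G); split=> // u Ju; have [c cE] := JP u Ju.
have uE : u = ev (\row_i c i) by rewrite cE; apply: eq_bigr => i _; rewrite mxE.
have [|d dE] := GP (\row_i c i); first by rewrite -uE.
exists d; rewrite uE dE (big_morph ev evD ev0).
by apply: eq_bigr => i _; rewrite evZ.
Qed.

End Noetherian.

(** * Finiteness of the ring of reduced norms *)

Lemma det_sum_rows (C : comNzRingType) (J : finType) n (p : 'I_n -> J -> C)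
    (y : J -> 'rV[C]_n) :
  \det (\matrix_(k < n) \sum_j p k j *: y j) =
  \sum_(f : {ffun 'I_n -> J}) (\prod_k p k (f k)) * \det (\matrix_(k < n) y (f k)).
Proof.
rewrite /determinant.
transitivity (\sum_(s : 'S_n) \sum_(f : {ffun 'I_n -> J})
    (-1) ^+ s * \prod_k (p k (f k) * y (f k) 0 (s k))).
  apply: eq_bigr => s _; rewrite -mulr_sumr; congr (_ * _).
  rewrite -(bigA_distr_bigA (fun k j => p k j * y j 0 (s k))).
  by apply: eq_bigr => k _; rewrite mxE summxE; apply: eq_bigr => j _; rewrite mxE.
rewrite exchange_big; apply: eq_bigr => f _ /=; rewrite mulr_sumr.
apply: eq_bigr => s _; rewrite big_split /= mulrCA; congr (_ * (_ * _)).
by apply: eq_bigr => k _; rewrite mxE.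
Qed.

(** Recovers the determinant of a matrix from [1 + X M], the form to which elimination applies. *)
Lemma coef_det_1DX (C : comNzRingType) n (M : 'M[C]_n) :
  (\det (1%:M + 'X *: map_mx polyC M))`_n = \det M.
Proof.
have prodP m (c d : 'I_m -> C) :
    let Q := \prod_(i < m) ((c i)%:P + 'X * (d i)%:P) in
    Q`_m = \prod_i d i /\ forall l, (m < l)%N -> Q`_l = 0.
  elim: m c d => [|m IHm] c d /=.
    by rewrite !big_ord0 coef1; split=> // -[|l] // _; rewrite coef1.
  rewrite !big_ord_recr /=; set Q := \prod_(_ < m) _; set e := \prod_(_ < m) _.
  have [Qm Qh] : Q`_m = e /\ forall l, (m < l)%N -> Q`_l = 0 by apply: IHm.
  have QE l : (Q * ((c ord_max)%:P + 'X * (d ord_max)%:P))`_l.+1 =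
      Q`_l.+1 * c ord_max + Q`_l * d ord_max.
    by rewrite mulrDr coefD coefMC mulrA coefMC coefMX.
  split; first by rewrite QE Qh // mul0r add0r Qm.
  by case=> // l ml; rewrite QE !Qh ?mul0r ?addr0 // ltnW.
rewrite /determinant coef_sum; apply: eq_bigr => s _.
have -> : (-1) ^+ s = ((-1) ^+ s)%:P :> {poly C} by rewrite rmorphXn /= rmorphN1.
rewrite coefCM; congr (_ * _).
have [<- _] := prodP n (fun i => (i == s i)%:R) (fun i => M i (s i)).
congr (polyseq _)`_n; apply: eq_bigr => i _; rewrite !mxE; congr (_ + _).
by rewrite rmorph_nat.
Qed.

Lemma det_perturb (C : comNzRingType) n (M Q : 'M[C]_n) x :
  exists w, \det (M + x *: Q) = \det M + x * w.
Proof.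
pose p := \det (map_mx polyC M + 'X *: map_mx polyC Q).
have pE y : p.[y] = \det (M + y *: Q).
  rewrite -[p.[y]]/(horner_eval y p) -det_map_mx map_mxD map_mxZ.
  rewrite -!map_mx_comp /= /horner_eval hornerX; congr (\det (_ + _ *: _));
    by apply/matrixP => i j; rewrite !mxE /= hornerC.
have {2}-> : M = M + 0 *: Q by rewrite scale0r addr0.
rewrite -!pE; elim/poly_ind: p {pE} => [|p c _]; first by exists 0; rewrite !horner0 mulr0 addr0.
by exists p.[x]; rewrite !hornerE ?mulr0 ?add0r addrC mulrC.
Qed.

(** * A lattice stable under an order, and the multipliers of its determinants *)

Section Lattice.
Variables (L : comNzRingType) (R : algType L) (m : nat) (r : 'I_m -> R).
Hypothesis rP : forall x : R, exists c : 'I_m -> L, x = \sum_i c i *: r i.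
Variables (E : fieldType) (sigma : {rmorphism L -> E}) (n : nat).
Variable tau : {rmorphism R -> 'M[E]_n.+1}.
Hypothesis tauZ : forall l x, tau (l *: x) = sigma l *: tau x.

Notation J := ('I_n.+1 * 'I_m)%type.

(** These vectors span over [L] the sum of the [e_k tau R], for [e_k] the standard basis, which is
    stable under right multiplication by [tau R]. *)
Definition lat (j : J) : 'rV[E]_n.+1 := row j.1 (tau (r j.2)).

Definition lat_det (f : {ffun 'I_n.+1 -> J}) : E := \det (\matrix_(k < n.+1) lat (f k)).

Definition lat_dets (o : E) : Prop :=
  exists c : {ffun 'I_n.+1 -> J} -> L, o = \sum_f sigma (c f) * lat_det f.

Definition multiplier (o : E) : Prop := forall x, lat_dets x -> lat_dets (o * x).

Lemma lat_dets0 : lat_dets 0.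
Proof. by exists (fun=> 0); rewrite big1 // => f _; rewrite rmorph0 mul0r. Qed.

Lemma lat_detsD x y : lat_dets x -> lat_dets y -> lat_dets (x + y).
Proof.
move=> [c ->] [d ->]; exists (fun f => c f + d f); rewrite -big_split.
by apply: eq_bigr => f _; rewrite rmorphD mulrDl.
Qed.

Lemma lat_detsZ l x : lat_dets x -> lat_dets (sigma l * x).
Proof.
move=> [c ->]; exists (fun f => l * c f); rewrite mulr_sumr.
by apply: eq_bigr => f _; rewrite rmorphM mulrA.
Qed.

Lemma lat_dets_sum (I : Type) (s : seq I) (f : I -> E) :
  (forall i, lat_dets (f i)) -> lat_dets (\sum_(i <- s) f i).
Proof.
move=> fP; elim/big_ind: _ => //; [exact: lat_dets0|exact: lat_detsD].
Qed.

Lemma lat_dets_gen f : lat_dets (lat_det f).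
Proof.
exists (fun g => (g == f)%:R); rewrite (bigD1 f) //= eqxx rmorph1 mul1r.
by rewrite big1 ?addr0 // => g /negPf ->; rewrite rmorph0 mul0r.
Qed.

Lemma multiplierP o : (forall f, lat_dets (o * lat_det f)) -> multiplier o.
Proof.
move=> oP _ [c ->]; rewrite mulr_sumr; apply: lat_dets_sum => f.
by rewrite mulrCA; apply: lat_detsZ.
Qed.

Lemma lat_dets_poly (M : 'M[{poly E}]_n.+1) (P : 'I_n.+1 -> J -> {poly L}) :
  (forall k, row k M = \sum_j map_poly sigma (P k j) *: map_mx polyC (lat j)) ->
  forall i, lat_dets (\det M)`_i.
Proof.
move=> MP i; have -> : M = \matrix_(k < n.+1) \sum_j map_poly sigma (P k j) *: map_mx polyC (lat j).
  by apply/row_matrixP => k; rewrite rowK.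
rewrite det_sum_rows coef_sum; apply: lat_dets_sum => f.
have -> : \matrix_(k < n.+1) map_mx polyC (lat (f k)) = map_mx polyC (\matrix_(k < n.+1) lat (f k)).
  by apply/row_matrixP => k; rewrite -map_row !rowK.
rewrite det_map_mx coefMC -rmorph_prod coef_map; apply: lat_detsZ; exact: lat_dets_gen.
Qed.

Lemma lat_dets_const (M : 'M[E]_n.+1) (P : 'I_n.+1 -> J -> L) :
  (forall k, row k M = \sum_j sigma (P k j) *: lat j) -> lat_dets (\det M).
Proof.
move=> MP; have -> : \det M = (\det M)%:P`_0 by rewrite coefC.
rewrite -det_map_mx.
apply: (lat_dets_poly (P := fun k j => (P k j)%:P)) => k.
rewrite -map_row MP; apply/rowP => i; apply/polyP => l.
rewrite !mxE !summxE coefC coef_sum; case: eqP => [->|l0].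
  by apply: eq_bigr => j _; rewrite !mxE map_polyC coefCM coefC.
rewrite big1 // => j _; rewrite !mxE map_polyC coefCM coefC.
by case: eqP l0 => // _ _; rewrite mulr0.
Qed.

Lemma lat_rows : exists cc : 'I_n.+1 -> R -> J -> L,
  forall k x, row k (tau x) = \sum_j sigma (cc k x j) *: lat j.
Proof.
have [c cP] : {c : R -> 'I_m -> L & forall x, x = \sum_i c x i *: r i}.
  exact: (choice (P := fun x (c : 'I_m -> L) => x = \sum_i c i *: r i)).
exists (fun k x j => c x j.2 *+ (j.1 == k)) => k x; rewrite {1}(cP x).
rewrite rmorph_sum linear_sum /=.
transitivity (\sum_k' \sum_i sigma (c x i *+ (k' == k)) *: lat (k', i)).
  rewrite (bigD1 k) //= [X in _ = _ + X]big1 ?addr0 => [|k' /negPf ->].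
    by apply: eq_bigr => i _; rewrite eqxx mulr1n tauZ linearZ.
  by rewrite big1 // => i _; rewrite mulr0n rmorph0 scale0r.
by rewrite pair_bigA; apply: eq_bigr => -[].
Qed.

Lemma lat_dets1 : lat_dets 1.
Proof.
have [cc ccP] := lat_rows; have -> : 1 = \det (tau 1) by rewrite rmorph1 det1.
exact: (lat_dets_const (P := fun k => cc k 1)).
Qed.

Lemma multiplier_lat_dets o : multiplier o -> lat_dets o.
Proof. by move=> /(_ 1 lat_dets1); rewrite mulr1. Qed.

Lemma multiplier0 : multiplier 0.
Proof. by move=> x _; rewrite mul0r; apply: lat_dets0. Qed.
Lemma multiplier1 : multiplier 1.
Proof. by move=> x; rewrite mul1r. Qed.
Lemma multiplierD o o' : multiplier o -> multiplier o' -> multiplier (o + o').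
Proof. by move=> oP oP' x xP; rewrite mulrDl; apply: lat_detsD; [apply: oP|apply: oP']. Qed.
Lemma multiplierM o o' : multiplier o -> multiplier o' -> multiplier (o * o').
Proof. by move=> oP oP' x xP; rewrite -mulrA; apply: oP; apply: oP'. Qed.

(** Only one row of a lattice matrix is rescaled: [s] times a lattice vector is its product by
    [tau c], again in the lattice. *)
Lemma multiplier_center c (s : E) : tau c = s%:M -> multiplier s.
Proof.
move=> cs; have [cc ccP] := lat_rows; apply: multiplierP => f.
pose d : 'rV[E]_n.+1 := \row_k if k == 0 then s else 1.
have -> : s * lat_det f = \det (diag_mx d *m \matrix_(k < n.+1) lat (f k)).
  rewrite det_mulmx det_diag (bigD1 0) //= big1 ?mulr1 => [|k k0]; first by rewrite mxE.
  by rewrite mxE (negPf k0).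
apply: (lat_dets_const (P := fun k j => if k == 0 then cc (f k).1 (r (f k).2 * c) j else (j == f k)%:R)) => k.
rewrite row_mul row_diag_mx -scalemxAl -rowE rowK mxE; case: (k == 0).
  by rewrite -ccP rmorphM cs /= [_ * _]mul_mx_scalar linearZ.
rewrite scale1r (bigD1 (f k)) //= eqxx rmorph1 scale1r big1 ?addr0 // => j /negPf ->.
by rewrite rmorph0 scale0r.
Qed.

(** Multiplying a lattice matrix by [polymx tau b] keeps its rows in the lattice, with polynomial
    coefficients, and multiplies its determinant. Polynomials are allowed because they occur as
    pivots in the elimination. *)
Lemma multiplier_det_poly (b : {poly R}) i : multiplier (\det (polymx tau b))`_i.
Proof.
have [cc ccP] := lat_rows; apply: multiplierP => f.
have -> : (\det (polymx tau b))`_i * lat_det f =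
    (\det (map_mx polyC (\matrix_(k < n.+1) lat (f k)) *m polymx tau b))`_i.
  by rewrite det_mulmx det_map_mx mulrC coefCM mulrC.
pose P (k : 'I_n.+1) j : {poly L} := \poly_(t < size b) cc (f k).1 (r (f k).2 * b`_t) j.
apply: (lat_dets_poly (P := P)) => k; rewrite row_mul -map_row rowK.
apply/rowP => s; apply/polyP => t; rewrite summxE coef_sum mxE coef_sum.
transitivity ((row (f k).1 (tau (r (f k).2 * b`_t))) 0 s).
  rewrite rmorphM [in RHS]mxE [in RHS]mxE; apply: eq_bigr => q _.
  by rewrite [map_mx _ _ _ _]mxE coefCM coef_polymx [lat _ _ _]mxE.
have E1 j : ((map_poly sigma (P k j) *: map_mx polyC (lat j)) 0 s)`_t = sigma (P k j)`_t * lat j 0 s.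
  by rewrite !mxE coefMC coef_map.
under [RHS]eq_bigr => j _ do rewrite E1 coef_poly.
case: ltnP => tb; last first.
  rewrite nth_default // mulr0 rmorph0 mxE mxE big1 // => j _.
  by rewrite rmorph0 mul0r.
by rewrite ccP summxE; apply: eq_bigr => j _; rewrite mxE.
Qed.

End Lattice.

(** * Reduction of block determinants to size one *)

Section Elimination.
Variables (R : nzRingType) (E : fieldType) (n : nat) (tau : {rmorphism R -> 'M[E]_n}).
Variable O : E -> Prop.
Hypotheses (O0 : O 0) (O1 : O 1) (OD : forall x y, O x -> O y -> O (x + y)).
Hypothesis OM : forall x y, O x -> O y -> O (x * y).
Hypothesis Odet : forall (b : {poly R}) i, O (\det (polymx tau b))`_i.

Lemma polymx_rmorphism :
  exists pt : {rmorphism {poly R} -> 'M[{poly E}]_n}, forall y, pt y = polymx tau y.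
Proof.
have pB : zmod_morphism (polymx tau).
  by move=> y z; apply: (addIr (polymx tau z)); rewrite -polymxD !subrK.
have pM : monoid_morphism (polymx tau).
  by split; [rewrite polymxC rmorph1 map_mx1|exact: polymxM].
pose pA := GRing.isZmodMorphism.Build _ _ (polymx tau) pB.
pose pX := GRing.isMonoidMorphism.Build _ _ (polymx tau) pM.
by exists (HB.pack_for {rmorphism {poly R} -> 'M[{poly E}]_n} (polymx tau) pA pX).
Qed.

Lemma polymxMXn y k : polymx tau (y * 'X^k) = 'X^k *: polymx tau y.
Proof.
apply/matrixP => i j; apply/polyP => l; rewrite coef_polymx coefMXn.
transitivity (('X^k * polymx tau y i j)`_l); last by rewrite [in RHS]mxE.
by rewrite coefXnM; case: ifP => _; [rewrite rmorph0 mxE|rewrite coef_polymx].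
Qed.

Definition poly_in (p : {poly E}) := forall i, O p`_i.

Lemma poly_inM p q : poly_in p -> poly_in q -> poly_in (p * q).
Proof.
move=> pO qO i; rewrite coefM; elim/big_ind: _ => // j _; exact: OM.
Qed.

Variable pt : {rmorphism {poly R} -> 'M[{poly E}]_n}.
Hypothesis ptE : forall y, pt y = polymx tau y.

Lemma det_flat_scalar (y : {poly R}) : \det (flat pt (y%:M : 'M_1)) = \det (pt y).
Proof.
rewrite (flat_reindex pt _ (e := fun i : 'I_n => (0 : 'I_1, i))).
  by congr (\det _); apply/matrixP => i j; rewrite !mxE /= mulr1n.
by exists snd => // -[i j]; rewrite ord1.
Qed.

(* Gaussian elimination modulo X^D: the pivots are invertible modulo X^D since
   their constant coefficients are 1. *)
Lemma det_elimination a (G : 'M[{poly R}]_a) D : map_mx (coefp 0) G = 1%:M ->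
  exists q w, poly_in q /\ \det (flat pt G) = q + 'X^D * w.
Proof.
elim: a G => [|a IHa] G G1.
  exists 1, 0; split; first by move=> i; rewrite coef1; case: (i == 0).
  have c0 : #|{: 'I_0 * 'I_n}| = 0%N by rewrite card_prod card_ord.
  by rewrite mulr0 addr0; move: (flat pt G); rewrite c0 => M; apply: det_mx00.
move: G G1; rewrite -[a.+1]/(1 + a)%N => G.
rewrite -(submxK G); set u := ursubmx G; set v := dlsubmx G; set W := drsubmx G.
rewrite [ulsubmx G]mx11_scalar; set p := ulsubmx G 0 0.
rewrite map_block_mx scalar_mx_block => /eq_block_mx [p1 u0 v0 W1].
(* [s] is divisible by [X], so the truncated geometric sum [t] inverts the pivot [p] modulo
   [X^D]. *)
pose s := 1 - p; have s0 : s`_0 = 0.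
  have := congr1 (fun M : 'M_1 => M 0 0) p1; rewrite !mxE /= !mulr1n => p1'.
  by rewrite coefB coef1 -p1' /coefp subrr.
have [d sd] : exists d, s = d * 'X.
  exists (drop_poly 1 s); rewrite -{1}(poly_take_drop 1 s) expr1.
  rewrite [take_poly 1 s](_ : _ = 0) ?add0r //; apply/polyP => i.
  by rewrite coef_take_poly coef0; case: i.
have sX : s ^+ D = d ^+ D * 'X^D by rewrite sd exprMn_comm //; apply: commr_polyX.
pose t := \sum_(k < D) s ^+ k.
have tp : t * p = 1 - s ^+ D.
  have ps : p = - (s - 1) by rewrite /s opprB subKr.
  have st : GRing.comm t (s - 1).
    apply: commr_sym; apply: commr_sum => k _; apply: commrX.
    by apply: commr_sym; apply: commrB; [exact: commr_refl|exact: commr1].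
  by rewrite ps mulrN st -subrX1 opprB.
(* Schur complement for the approximate inverse [t]. Row reduction leaves [V] times [X^D] below the
   pivot instead of 0, which changes the determinant by a multiple of [X^D] only. *)
pose W' := W - v *m t%:M *m u.
have [|q [w [qO qE]]] := IHa W'.
  by rewrite /W' map_mxB map_mxM W1 u0 mulmx0 subr0.
pose M1 : 'M[{poly R}]_(1 + a) := block_mx 1%:M 0 (- (v *m t%:M)) 1%:M.
have M1det : \det (flat pt M1) = 1.
  by rewrite det_flat_lblock ?rmorph0 // !flat1 !det1 mulr1.
pose V := v *m (d ^+ D)%:M.
have vV : v - v *m t%:M *m p%:M = map_mx (fun y => y * 'X^D) V.
  rewrite -mulmxA -scalar_mxM tp -{1}[v]mulmx1 -mulmxBr.
  have -> : 1%:M - (1 - s ^+ D)%:M = (s ^+ D)%:M :> 'M_1.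
    by rewrite -raddfB opprB addrC subrK.
  apply/matrixP => i j; rewrite sX !mxE !big_ord1 !mxE !ord1 eqxx !mulr1n.
  by rewrite mulrA.
have -> : \det (flat pt (block_mx p%:M u v W)) =
    \det (flat pt (block_mx p%:M u (map_mx (fun y => y * 'X^D) V) W')).
  rewrite -[LHS]mul1r -M1det -det_mulmx -flatM; congr (\det (flat _ _)).
  rewrite mulmx_block !mul1mx !mul0mx !addr0 !mulNmx -vV; congr block_mx.
    by rewrite addrC.
  by rewrite addrC.
rewrite det_flat_block.
have -> : flat pt (map_mx (fun y => y * 'X^D) V) = 'X^D *: flat pt V.
  apply/matrixP => i j; rewrite [LHS]mxE [map_mx _ _ _ _]mxE ptE polymxMXn.
  by rewrite [LHS]mxE [RHS]mxE [flat pt V _ _]mxE ptE.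
have -> : block_mx (flat pt p%:M) (flat pt u) ('X^D *: flat pt V) (flat pt W') =
    block_mx (flat pt p%:M) (flat pt u) 0 (flat pt W') + 'X^D *: block_mx 0 0 (flat pt V) 0.
  by rewrite scale_block_mx add_block_mx !scaler0 !addr0 add0r.
have [w' ->] := det_perturb (block_mx (flat pt p%:M) (flat pt u) 0 (flat pt W'))
  (block_mx 0 0 (flat pt V) 0) 'X^D.
rewrite det_ublock det_flat_scalar qE ptE.
exists (\det (polymx tau p) * q), (\det (polymx tau p) * w + w'); split.
  by apply: poly_inM => // i; apply: Odet.
by rewrite !mulrDr -addrA mulrCA.
Qed.

Lemma det_flat_in a (H : 'M[R]_a) : O (\det (flat tau H)).
Proof.
set N := #|{: 'I_a * 'I_n}|.
(* The wanted determinant is the coefficient of [X^N] in that of [1 + X H]; precision [N.+1]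
   protects it from the error term. *)
have [|q [w [qO qE]]] := @det_elimination a (1%:M + 'X *: map_mx polyC H) N.+1.
  apply/matrixP => i j; rewrite !mxE /coefp coefD coefXM /= addr0.
  by case: (i == j); rewrite ?coef1 ?coef0.
have flatE : flat pt (1%:M + 'X *: map_mx polyC H) = 1%:M + 'X *: map_mx polyC (flat tau H).
  apply/matrixP => i j; rewrite [LHS]mxE.
  case ei : (enum_val i) => [k p]; case ej : (enum_val j) => [l s] /=.
  have -> : (1%:M + 'X *: map_mx polyC H) k l = (k == l)%:R + (H k l)%:P * 'X^1.
    by rewrite !mxE expr1 commr_polyX.
  rewrite rmorphD rmorph_nat ptE polymxZXn expr1 !mxE ei ej /=; congr (_ + _).
  by rewrite -(inj_eq enum_val_inj) ei ej xpair_eqE; case: (k == l); rewrite mxE.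
have := coef_det_1DX (flat tau H); rewrite -flatE qE coefD coefXnM -/N ltnSn addr0 => <-.
exact: qO.
Qed.

End Elimination.

(** * The ring of reduced norms is noetherian over [L] *)

Section NrdRing.
Variables (L : idomainType) (A : falgType {fraction L}) (sepA : separable_algebra A).
Variables (R : algType L) (iota : {rmorphism R -> A}) (ordR : is_order iota).

Notation nrd := (@nrd L A R iota _).
Notation I := (nrd_ring iota).

Lemma iota_center c : center c -> center (iota c).
Proof.
move=> cC y; have [_ _ _ /(_ y) [n [k [r ->]]]] := ordR.
rewrite mulr_sumr mulr_suml; apply: eq_bigr => i _.
by rewrite -scalerAl -scalerAr -!rmorphM cC.
Qed.

Lemma nrd_center a (H : 'M[R]_a) : center (nrd H).
Proof. exact: Nrd_center. Qed.

Lemma nrdM a (H H' : 'M[R]_a) : nrd (H *m H') = nrd H * nrd H'.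
Proof. by rewrite /Defs.nrd map_mxM NrdM. Qed.

Lemma nrd1 a : nrd (1%:M : 'M[R]_a) = 1.
Proof. by rewrite /Defs.nrd map_mx1 Nrd1. Qed.

Lemma nrd_ublock a1 a2 (H1 : 'M[R]_a1) V (H2 : 'M[R]_a2) :
  nrd (block_mx H1 V 0 H2) = nrd H1 * nrd H2.
Proof. by rewrite /Defs.nrd map_block_mx map_mx0 Nrd_ublock. Qed.

Lemma nrd_lblock a1 a2 (H1 : 'M[R]_a1) V (H2 : 'M[R]_a2) :
  nrd (block_mx H1 0 V H2) = nrd H1 * nrd H2.
Proof. by rewrite /Defs.nrd map_block_mx map_mx0 Nrd_lblock. Qed.

Lemma nrd_ring_nrd a (H : 'M[R]_a) : I (nrd H).
Proof.
case: a H => [|a] H; last by apply: span_gen; exists a, H.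
rewrite [H](_ : _ = 1%:M) ?nrd1; last by rewrite [LHS]flatmx0 [RHS]flatmx0.
by apply: span_gen; exists 0%N, 1%:M; rewrite nrd1.
Qed.

Lemma nrd_ring_submodule : submodule (iota @` @center R) I.
Proof. exact: span_submodule. Qed.

Lemma nrd_ring_center z : I z -> center z.
Proof.
apply: (@span_min _ _ _ (@center A)).
  split; [exact: center0|exact: centerD|].
  by move=> _ z' [c cC <-] z'C; apply: centerM => //; apply: iota_center.
by move=> _ [a [H ->]]; apply: nrd_center.
Qed.

(** A product of two reduced norms, of matrices of any sizes, is the reduced norm of a block
    diagonal matrix. *)
Lemma nrd_ringM x y : I x -> I y -> I (x * y).
Proof.
move=> + yI; move: x; have [I0 ID IZ] := nrd_ring_submodule.
apply: (@span_min _ _ _ (fun x => I (x * y))).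
  split; first by rewrite mul0r.
    by move=> x x' xI x'I; rewrite mulrDl; apply: ID.
  by move=> c x cC xI; rewrite -mulrA; apply: IZ.
move=> _ [a [H ->]]; move: y yI.
apply: (@span_min _ _ _ (fun y => I (nrd H * y))).
  split; first by rewrite mulr0.
    by move=> x x' xI x'I; rewrite mulrDr; apply: ID.
  by move=> c x cC xI; rewrite mulrA nrd_center -mulrA; apply: IZ.
move=> _ [b [H' ->]]; rewrite -(nrd_lblock H 0 H'); exact: nrd_ring_nrd.
Qed.

Lemma nrd_ring_subring : is_subring I.
Proof.
have [I0 ID _] := nrd_ring_submodule; split => //.
  by rewrite -(nrd1 0); apply: nrd_ring_nrd.
exact: nrd_ringM.
Qed.

Lemma nrd_ringL l z : I z -> I (tofrac l *: z).
Proof.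
have [_ _ IZ] := nrd_ring_submodule; have [_ iotaZ _ _] := ordR => zI.
rewrite -[z]mul1r scalerAl; apply: IZ => //; exists (l *: 1).
  by move=> y; rewrite -scalerAl -scalerAr mul1r mulr1.
by rewrite iotaZ rmorph1.
Qed.

Section Component.
Variables (E : fieldType) (n : nat) (rho : {rmorphism A -> 'M[E]_n.+1}).
Hypothesis spl : splitting rho.

Lemma splitting_scalars : exists sigma : {rmorphism L -> E},
  forall l a, rho (tofrac l *: a) = sigma l *: rho a.
Proof.
pose f l := rho (tofrac l *: (1 : A)) 0 0.
have fM k (k' : {fraction L}) :
    rho ((k * k') *: (1 : A)) 0 0 = rho (k *: (1 : A)) 0 0 * rho (k' *: (1 : A)) 0 0.
  by rewrite -scalerA (splittingZ spl) mxE.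
have [|||||sigma sigmaP] := @rmorph_of_rel L E (fun l s => s = f l).
- by move=> l; exists (f l).
- by move=> l s s' -> ->.
- by rewrite /f rmorph1 scale1r rmorph1 mxE eqxx.
- by move=> l s l' s' -> ->; rewrite /f rmorphB scalerBl rmorphB !mxE.
- by move=> l s l' s' -> ->; rewrite /f rmorphM fM.
by exists sigma => l a; rewrite (splittingZ spl) (sigmaP l (f l)).
Qed.

Lemma nrd_ring_finite : exists (sigma : {rmorphism L -> E}) k (x : 'I_k -> E),
  (forall l a, rho (tofrac l *: a) = sigma l *: rho a) /\
  forall z, I z -> exists c : 'I_k -> L, rho z 0 0 = \sum_i sigma (c i) * x i.
Proof.
have [sigma sigmaP] := splitting_scalars.
have [_ iotaZ [m [r rP]] _] := ordR.
pose tau : {rmorphism R -> 'M[E]_n.+1} := rho \o iota.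
have tauZ l x : tau (l *: x) = sigma l *: tau x by rewrite /tau /= iotaZ sigmaP.
pose O := multiplier r sigma tau.
have Odet a (H : 'M[R]_a) : O (\det (flat tau H)).
  have [pt ptE] := polymx_rmorphism tau; apply: (det_flat_in _ _ _ _ _ ptE).
  - exact: multiplier0.
  - exact: multiplier1.
  - exact: multiplierD.
  - exact: multiplierM.
  - exact: (multiplier_det_poly rP tauZ).
have OI z : I z -> O (rho z 0 0).
  move=> zI; suff [] : center z /\ O (rho z 0 0) by [].
  move: z zI; apply: (@span_min _ _ _ (fun z => center z /\ O (rho z 0 0))).
    split.
    - by split; [exact: center0|rewrite rmorph0 mxE; exact: multiplier0].
    - move=> x y [xC xO] [yC yO]; split; first exact: centerD.
      by rewrite rmorphD mxE; apply: multiplierD.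
    - move=> _ x [c cC <-] [xC xO]; have icC := iota_center cC; split; first exact: centerM.
      rewrite rmorphM (splitting_center spl icC) (splitting_center spl xC).
      rewrite -[_ * _]/(_ *m _) -scalar_mxM mxE eqxx mulr1n; apply: multiplierM => //.
      exact: (multiplier_center rP tauZ (splitting_center spl icC : tau c = _)).
  move=> x [d [M ->]]; split; first exact: nrd_center.
  rewrite (Nrd_split sepA _ spl) mxE eqxx mulr1n.
  have -> : flat rho (map_mx iota M) = flat tau M by apply/matrixP => i j; rewrite !mxE.
  exact: Odet.
pose T := {ffun 'I_n.+1 -> 'I_n.+1 * 'I_m}.
exists sigma, #|{: T}|, (fun i => lat_det r tau (enum_val i : T)); split=> // z zI.
have [c cE] := multiplier_lat_dets rP tauZ (OI z zI).
exists (fun i => c (enum_val i)); rewrite cE.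
by rewrite (reindex _ (onW_bij _ (enum_val_bij T))).
Qed.

End Component.

Hypothesis noethL : noetherian L.

(** The image of [J] in the field [E] of one component is finitely generated over [L]; what vanishes
    there satisfies [z * e = 0] and is left to the smaller idempotent [g - e]. *)
Lemma nrd_ring_noetherian (J : A -> Prop) :
  (forall z, J z -> I z) -> J 0 -> (forall x y, J x -> J y -> J (x + y)) ->
  (forall l x, J x -> J (tofrac l *: x)) ->
  exists k (g : 'I_k -> A), (forall i, J (g i)) /\
    forall z, J z -> exists c : 'I_k -> L, z = \sum_i tofrac (c i) *: g i.
Proof.
suff H g : center g -> g * g = g -> forall J : A -> Prop,
  (forall z, J z -> I z) -> J 0 -> (forall x y, J x -> J y -> J (x + y)) ->
  (forall l x, J x -> J (tofrac l *: x)) -> (forall z, J z -> z * g = z) ->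
  exists k (g : 'I_k -> A), (forall i, J (g i)) /\
    forall z, J z -> exists c : 'I_k -> L, z = \sum_i tofrac (c i) *: g i.
  move=> JI J0 JD JZ; apply: (H 1) => //; [exact: center1|exact: mulr1|].
  by move=> z _; rewrite mulr1.
clear J; move: g; apply: (ideal_dim_center_ind (A := A)).
  move=> J _ _ _ _ Jz; exists 0%N, (fun=> 0); split=> [[]//|z /Jz].
  by rewrite mulr0 => <-; exists (fun=> 0); rewrite big_ord0.
move=> g gC gg g0 IH J JI J0 JD JZ Jg.
have [E [n [rho [e [spl re [eC ee] eK [eg geC gege lt]]]]]] := component_in sepA gC gg g0.
have [sigma [k [x [sigmaP xP]]]] := nrd_ring_finite spl.
have Jsum m (f : 'I_m -> A) : (forall i, J (f i)) -> J (\sum_i f i).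
  by move=> Jf; elim/big_ind: _.
have [||||||| m [t [tJ tP]]] := @noetherian_action L noethL E (fun l s => sigma l * s) k x
    (fun s => exists2 z, J z & rho z 0 0 = s).
- by move=> c d u; rewrite rmorphD mulrDl.
- by move=> c u v; rewrite mulrDr.
- by move=> c d u; rewrite rmorphM mulrA.
- by exists 0; rewrite // rmorph0 mxE.
- by move=> _ _ [z zJ <-] [w wJ <-]; exists (z + w); [exact: JD|rewrite rmorphD mxE].
- by move=> c _ [z zJ <-]; exists (tofrac c *: z); [exact: JZ|rewrite sigmaP mxE].
- by move=> _ [z zJ <-]; apply: xP; apply: JI.
have [w wP] : {w : 'I_m -> A & forall i, J (w i) /\ rho (w i) 0 0 = t i}.
  by apply: (choice (P := fun i w => J w /\ rho w 0 0 = t i)) => i; have [w] := tJ i; exists w.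
have [|||||k' [g' [g'J g'P]]] := IH _ geC gege lt (fun z => J z /\ z * e = 0).
- by move=> z [/JI].
- by split; rewrite ?mul0r.
- by move=> y z [yJ ye] [zJ ze]; split; [exact: JD|rewrite mulrDl ye ze addr0].
- by move=> l z [zJ ze]; split; [exact: JZ|rewrite -scalerAl ze scaler0].
- by move=> z [zJ ze]; rewrite mulrBr ze subr0 Jg.
exists (m + k')%N, (fun i => match split i with inl i => w i | inr i => g' i end); split.
  by move=> i; case: (split i) => j; [have [] := wP j|have [] := g'J j].
move=> z zJ; have [|c cE] := tP (rho z 0 0); first by exists z.
pose y := z - \sum_i tofrac (c i) *: w i.
have wsJ : J (\sum_i tofrac (c i) *: w i).
  by apply: Jsum => i; apply: JZ; have [] := wP i.
have yJ : J y.
  apply: (JD) => //; rewrite -scaleN1r -(rmorphN1 (@tofrac L)); exact: JZ.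
have yC : center y by apply: nrd_ring_center; apply: JI.
have ye : y * e = 0.
  apply: eK => //; rewrite (splitting_center spl yC) rmorphB !mxE rmorph_sum summxE cE.
  rewrite [X in _ - X](_ : _ = \sum_i sigma (c i) * t i) ?subrr ?raddf0 //.
  by apply: eq_bigr => i _; rewrite sigmaP mxE; have [_ ->] := wP i.
have [|d dE] := g'P y; first by [].
exists (fun i => match split i with inl i => c i | inr i => d i end).
rewrite big_split_ord /=.
under eq_bigr => i _ do rewrite (unsplitK (inl i)).
under [X in _ + X]eq_bigr => i _ do rewrite (unsplitK (inr i)).
by rewrite -dE /y addrC subrK.
Qed.

End NrdRing.

(** * Presentations and Fitting ideals *)

Section FreeModules.
Variable R : nzRingType.
Implicit Types M N P : lmodType R.

Definition onto M N (f : M -> N) : Prop := forall y, exists x, f x = y.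

Lemma linear_rows M a (x : 'I_a -> M) :
  exists p : {linear 'rV[R]_a -> M}, forall u, p u = \sum_i u 0 i *: x i.
Proof.
pose f (u : 'rV[R]_a) := \sum_i u 0 i *: x i.
have fL : linear f.
  move=> c u v; rewrite /f scaler_sumr -big_split; apply: eq_bigr => i _.
  by rewrite !mxE scalerDl scalerA.
pose fI := GRing.isLinear.Build R _ _ _ f fL.
by exists (HB.pack_for {linear 'rV[R]_a -> M} f fI).
Qed.

Lemma linear_row_mx M a b (p : {linear 'rV[R]_a -> M}) (q : {linear 'rV[R]_b -> M}) :
  exists s : {linear 'rV[R]_(a + b) -> M}, forall u v, s (row_mx u v) = p u + q v.
Proof.
pose f (u : 'rV[R]_(a + b)) := p (lsubmx u) + q (rsubmx u).
have fL : linear f.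
  by move=> c u v; rewrite /f !linearP /= scalerDr addrACA.
pose fI := GRing.isLinear.Build R _ _ _ f fL.
exists (HB.pack_for {linear 'rV[R]_(a + b) -> M} f fI) => u v /=.
by rewrite /f row_mxKl row_mxKr.
Qed.

Lemma linear_delta M a (p : {linear 'rV[R]_a -> M}) u :
  p u = \sum_i u 0 i *: p (delta_mx 0 i).
Proof.
rewrite {1}[u]row_sum_delta linear_sum; apply: eq_bigr => i _.
by rewrite linearZ.
Qed.

Lemma lift_matrix M a b (p : {linear 'rV[R]_a -> M}) (q : {linear 'rV[R]_b -> M}) :
  onto q -> exists V : 'M[R]_(a, b), forall u, p u = q (u *m V).
Proof.
move=> q_onto; have [v vP] : {v : 'I_a -> 'rV[R]_b & forall i, q (v i) = p (delta_mx 0 i)}.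
  by apply: (choice (P := fun i v => q v = p (delta_mx 0 i))) => i; apply: q_onto.
exists (\matrix_i v i) => u; rewrite mulmx_sum_row linear_sum linear_delta.
by apply: eq_bigr => i _; rewrite rowK linearZ /= vP.
Qed.

Lemma lift_linear M N a (p : {linear 'rV[R]_a -> N}) (g : {linear M -> N}) :
  onto g -> exists q : {linear 'rV[R]_a -> M}, forall u, g (q u) = p u.
Proof.
move=> g_onto; have [x xP] : {x : 'I_a -> M & forall i, g (x i) = p (delta_mx 0 i)}.
  by apply: (choice (P := fun i v => g v = p (delta_mx 0 i))) => i; apply: g_onto.
have [q qE] := linear_rows x; exists q => u; rewrite qE linear_sum linear_delta.
by apply: eq_bigr => i _; rewrite linearZ /= xP.
Qed.

Lemma rows_mul M a b (p : {linear 'rV[R]_a -> M}) (H : 'M[R]_(b, a)) :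
  (forall i, p (row i H) = 0) -> forall v, p (v *m H) = 0.
Proof.
move=> pH v; rewrite mulmx_sum_row linear_sum big1 // => i _.
by rewrite linearZ /= pH scaler0.
Qed.

Definition kernel_rows M a b (p : {linear 'rV[R]_a -> M}) (h : 'M[R]_(b, a)) : Prop :=
  forall u, p u = 0 <-> exists v : 'rV[R]_b, u = v *m h.

Lemma kernel_rows_factor M a b c (p : {linear 'rV[R]_a -> M}) (h : 'M[R]_(b, a))
    (H : 'M[R]_(c, a)) : kernel_rows p h -> (forall i, p (row i H) = 0) ->
  exists X : 'M[R]_(c, b), H = X *m h.
Proof.
move=> ph pH; have [x xP] : {x : 'I_c -> 'rV[R]_b & forall i, row i H = x i *m h}.
  by apply: (choice (P := fun i x => row i H = x *m h)) => i; apply/ph.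
by exists (\matrix_i x i); apply/row_matrixP => i; rewrite row_mul rowK.
Qed.

(* Two systems of generators [p] (with relations [h]) and [q] are joined into one:
   its relations are generated by those of [p] and by the expression of [q] in
   terms of [p]. *)
Lemma join_generators M a b c (p : {linear 'rV[R]_a -> M}) (q : {linear 'rV[R]_c -> M})
    (h : 'M[R]_(b, a)) : onto p -> onto q -> kernel_rows p h ->
  exists (V : 'M[R]_(c, a)) (U : 'M[R]_(a, c)) (s : {linear 'rV[R]_(a + c) -> M}),
    [/\ onto s, kernel_rows s (block_mx h 0 (- V) 1%:M),
        forall x y, s (row_mx x y) = p (x + y *m V) &
        forall H : 'M_c, (forall i, q (row i H) = 0) ->
          forall v, s (v *m block_mx 1%:M (- U) 0 H) = 0].
Proof.
move=> p_onto q_onto ph.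
have [V VP] := lift_matrix q p_onto; have [U UP] := lift_matrix p q_onto.
have [s sP] := linear_row_mx p q.
have sE x y : s (row_mx x y) = p (x + y *m V) by rewrite sP VP linearD.
exists V, U, s; split=> //.
- by move=> x; have [u <-] := p_onto x; exists (row_mx u 0); rewrite sE mul0mx addr0.
- move=> u; rewrite -[u]hsubmxK sE ph; split=> [[v e]|[v]].
    exists (row_mx v (rsubmx u)); rewrite mul_row_block mulmx0 mulmx1 add0r mulmxN.
    by rewrite -e addrK.
  rewrite -[v]hsubmxK mul_row_block mulmx0 mulmx1 add0r mulmxN => /eq_row_mx [-> ->].
  by exists (lsubmx v); rewrite subrK.
- move=> H qH v; rewrite -[v]hsubmxK mul_row_block mulmx0 mulmx1 addr0 mulmxN sP UP.
  by rewrite -linearD /= addrA subrr add0r rows_mul.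
Qed.

End FreeModules.

Section FittingIdeals.
Variables (L : idomainType) (A : falgType {fraction L}) (sepA : separable_algebra A).
Variables (R : algType L) (iota : {rmorphism R -> A}) (ordR : is_order iota).
Hypothesis noethL : noetherian L.

Notation nrd := (@nrd L A R iota _).
Notation I := (nrd_ring iota).
Implicit Types M : lmodType R.

(** [R^a] is finitely generated over the noetherian [L], so the kernel is too, and generators over
    [L] are generators over [R]. *)
Lemma presentation_exists M : fin_gen_module M ->
  exists a b (h : 'M[R]_(b, a)), presents M h.
Proof.
move=> [a [e eP]]; have [p pE] := linear_rows e.
have p_onto : onto p.
  move=> x; have [c ->] := eP x; exists (\row_i c i); rewrite pE.
  by apply: eq_bigr => i _; rewrite mxE.
have [_ _ [m [r rP]] _] := ordR.
pose T := ('I_a * 'I_m)%type.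
pose act (l : L) (u : 'rV[R]_a) := (l%:A : R) *: u.
have actE l u i : act l u 0 i = l *: u 0 i by rewrite mxE mulr_algl.
have [||||||| b [G [G0 GP]]] := @noetherian_action L noethL _ act #|{: T}|
    (fun t => r (enum_val t : T).2 *: delta_mx 0 (enum_val t : T).1) (fun u => p u = 0).
- by move=> c d u; apply/rowP => i; rewrite actE [in RHS]mxE !actE scalerDl.
- by move=> c u v; apply/rowP => i; rewrite actE [in RHS]mxE !actE [in LHS]mxE scalerDr.
- by move=> c d u; apply/rowP => i; rewrite !actE scalerA.
- exact: linear0.
- by move=> u v pu pv; rewrite linearD /= pu pv addr0.
- by move=> c u pu; rewrite /act linearZ /= pu scaler0.
- move=> u _; have [c cP] : {c : 'I_a -> 'I_m -> L & forall i, u 0 i = \sum_j c i j *: r j}.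
    by apply: (choice (P := fun i (c : 'I_m -> L) => u 0 i = \sum_j c j *: r j)) => i; apply: rP.
  exists (fun t => c (enum_val t : T).1 (enum_val t : T).2).
  transitivity (\sum_(t : T) act (c t.1 t.2) (r t.2 *: delta_mx 0 t.1)); last first.
    by rewrite (reindex _ (onW_bij _ (enum_val_bij T))).
  rewrite -(pair_bigA _ (fun i j => act (c i j) (r j *: delta_mx 0 i))) /=.
  rewrite [LHS]row_sum_delta; apply: eq_bigr => i _; rewrite cP scaler_suml.
  by apply: eq_bigr => j _; rewrite /act scalerA mulr_algl.
exists a, b, (\matrix_i G i), p; split=> // u; split=> [pu|[v ->]].
  have [c cE] := GP u pu; exists (\row_i (c i)%:A); rewrite cE mulmx_sum_row.
  by apply: eq_bigr => i _; rewrite rowK mxE.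
by apply: rows_mul => i; rewrite rowK.
Qed.

(* The generators of all Fitting ideals of [M] together. *)
Definition relation_norms M : set A :=
  [set z | exists a (p : {linear 'rV[R]_a -> M}) (H : 'M[R]_a),
     [/\ onto p, forall i, p (row i H) = 0 & z = nrd H]].

Lemma relation_norms_nrd_ring M : relation_norms M `<=` I.
Proof. by move=> _ [a [p [H [_ _ ->]]]]; apply: nrd_ring_nrd. Qed.

Lemma submodule_nrd_ring : submodule I I.
Proof. by have [I0 _ ID IM] := nrd_ring_subring sepA iota; split. Qed.

Lemma Fitt_relation_norms M a b (h : 'M[R]_(b, a)) :
  presents M h -> Fitt iota h `<=` span I (relation_norms M).
Proof.
move=> [p [p_onto ph]]; apply: span_mono => _ [f _ ->].
exists a, p, (rowsub f h); split=> // i; apply/ph.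
by exists (delta_mx 0 (f i)); rewrite -rowE; apply/rowP => j; rewrite !mxE.
Qed.

(** All relations of the joined generators are listed first, then redundant ones containing [H]. The
    rows that eliminate the added generators complete an old minor; the redundant rows form a block
    triangular matrix with diagonal blocks 1 and [H]. *)
Lemma Fitt_extend M a b (h : 'M[R]_(b, a)) c (q : {linear 'rV[R]_c -> M}) (H : 'M[R]_c) :
  presents M h -> onto q -> (forall i, q (row i H) = 0) ->
  exists a' b' (h' : 'M[R]_(b', a')),
    [/\ presents M h', Fitt iota h `<=` Fitt iota h' & Fitt iota h' (nrd H)].
Proof.
move=> [p [p_onto ph]] q_onto qH.
have [V [U [s [s_onto sh _ sH]]]] := join_generators p_onto q_onto ph.
exists (a + c)%N, (b + c + (a + c))%N,
  (col_mx (block_mx h 0 (- V) 1%:M) (block_mx 1%:M (- U) 0 H)).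
split.
- exists s; split=> // u; split=> [/sh [v ->]|[v ->]].
    by exists (row_mx v 0); rewrite mul_row_col mul0mx addr0.
  rewrite -[v]hsubmxK mul_row_col linearD /= sH // addr0; apply/sh.
  by exists (lsubmx v).
- apply: span_mono => _ [f f_incr ->].
  (* [Fitt] admits increasing selections only, so the old rows come before the [c] eliminating
     rows. *)
  pose f' (i : 'I_(a + c)) : 'I_(b + c + (a + c)) := lshift (a + c)
    match split i with inl j => lshift c (f j) | inr j => rshift b j end.
  exists f'.
    move=> i j; rewrite /f' /=; case: (split_ordP i) => i' ->; case: (split_ordP j) => j' -> /=.
    - exact: f_incr.
    - by move=> _; apply: ltn_addr.
    - by rewrite ltnNge ltnW // ltn_addr.
    - by rewrite !ltn_add2l.
  have -> : rowsub f' (col_mx (block_mx h 0 (- V) 1%:M) (block_mx 1%:M (- U) 0 H)) =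
      block_mx (rowsub f h) 0 (- V) 1%:M.
    apply/matrixP => i j; rewrite mxE /f' col_mxEu.
    case: (split_ordP i) => i' ->; case: (split_ordP j) => j' -> /=.
    - by rewrite !block_mxEul mxE.
    - by rewrite !block_mxEur !mxE.
    - by rewrite !block_mxEdl.
    - by rewrite !block_mxEdr.
  by rewrite nrd_lblock // nrd1 // mulr1.
- apply: span_gen; exists (fun i => rshift (b + c) i).
    by move=> i j ij /=; rewrite ltn_add2l.
  have -> : rowsub (fun i => rshift (b + c) i)
      (col_mx (block_mx h 0 (- V) 1%:M) (block_mx 1%:M (- U) 0 H)) =
      block_mx 1%:M (- U) 0 H by apply/matrixP => i j; rewrite mxE col_mxEd.
  by rewrite nrd_ublock // nrd1 // mul1r.
Qed.

(** [h] is generalized before the induction: for a sum, the second enlargement starts from the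
    result of the first. *)
Lemma Fitt_extend_span M a b (h : 'M[R]_(b, a)) z :
  presents M h -> span I (relation_norms M) z ->
  exists a' b' (h' : 'M[R]_(b', a')),
    [/\ presents M h', Fitt iota h `<=` Fitt iota h' & Fitt iota h' z].
Proof.
move=> hM zM; move: a b h hM.
apply: (span_min (X := fun z => forall a b (h : 'M[R]_(b, a)), presents M h ->
  exists a' b' (h' : 'M[R]_(b', a')),
    [/\ presents M h', Fitt iota h `<=` Fitt iota h' & Fitt iota h' z])) zM.
  split.
  - move=> a b h hM; exists a, b, h; split=> //.
    by have [] := span_submodule I [set z | exists2 f : 'I_a -> 'I_b,
       (forall i j : 'I_a, (i < j)%N -> (f i < f j)%N) & z = nrd (rowsub f h)].
  - move=> x y xP yP a b h hM.
    have [a1 [b1 [h1 [h1M sub1 x1]]]] := xP _ _ _ hM.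
    have [a2 [b2 [h2 [h2M sub2 y2]]]] := yP _ _ _ h1M.
    exists a2, b2, h2; split=> //; first by move=> u /sub1 /sub2.
    have [_ FD _] := span_submodule I [set z | exists2 f : 'I_a2 -> 'I_b2,
       (forall i j : 'I_a2, (i < j)%N -> (f i < f j)%N) & z = nrd (rowsub f h2)].
    by apply: FD => //; apply: sub2.
  - move=> c x cI xP a b h hM; have [a1 [b1 [h1 [h1M sub1 x1]]]] := xP _ _ _ hM.
    exists a1, b1, h1; split=> //.
    have [_ _ FM] := span_submodule I [set z | exists2 f : 'I_a1 -> 'I_b1,
       (forall i j : 'I_a1, (i < j)%N -> (f i < f j)%N) & z = nrd (rowsub f h1)].
    exact: FM.
by move=> _ [c [q [H [q_onto qH ->]]]] a b h hM; apply: Fitt_extend hM q_onto qH.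
Qed.

Lemma Fitt_submodule a b (h : 'M[R]_(b, a)) : submodule I (Fitt iota h).
Proof. exact: span_submodule. Qed.

(** By noetherianity finitely many elements generate the span, and they are absorbed one after the
    other by enlarging a presentation. *)
Lemma Fitt_relation_norms_eq M : fin_gen_module M ->
  exists a b (h : 'M[R]_(b, a)), presents M h /\ Fitt iota h = span I (relation_norms M).
Proof.
move=> /presentation_exists [a0 [b0 [h0 h0M]]].
have subI : span I (relation_norms M) `<=` I.
  by apply: span_min; [exact: submodule_nrd_ring|exact: relation_norms_nrd_ring].
have algI l : I (tofrac l *: 1).
  by apply: nrd_ringL => //; have [] := nrd_ring_subring sepA iota.
have Lsub X l z : submodule I X -> X z -> X (tofrac l *: z).
  move=> [_ _ XM] Xz; rewrite -[z]mul1r scalerAl; exact: XM.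
have [||||k [g [gM gP]]] := @nrd_ring_noetherian _ _ sepA _ _ ordR noethL (span I (relation_norms M)).
- exact: subI.
- by have [] := span_submodule I (relation_norms M).
- by have [_ D _] := span_submodule I (relation_norms M); exact: D.
- by move=> l x; apply: Lsub; apply: span_submodule.
have [a [b [h [hM hg]]]] : exists a b (h : 'M[R]_(b, a)), presents M h /\ forall i, Fitt iota h (g i).
  elim: k g gM {gP} => [|k IHk] g gM; first by exists a0, b0, h0; split=> // -[].
  have [a [b [h [hM hg]]]] := IHk _ (fun i => gM (lift ord0 i)).
  have [a' [b' [h' [h'M sub gh]]]] := Fitt_extend_span hM (gM ord0).
  exists a', b', h'; split=> // i; case: (unliftP ord0 i) => [j|] -> //.
  by apply: sub; exact: (hg j).
exists a, b, h; split=> //; apply/seteqP; split; first exact: Fitt_relation_norms.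
move=> z /gP [c ->]; apply: submodule_sum (Fitt_submodule h) _ _ _ => i.
exact: Lsub (Fitt_submodule h) _.
Qed.

Lemma Fitt_maxE M : fin_gen_module M -> Fitt_max iota M = span I (relation_norms M).
Proof.
move=> Mfg; have [a [b [h [hM hE]]]] := Fitt_relation_norms_eq Mfg.
have sub J : Fitt_ideals iota M J -> J `<=` span I (relation_norms M).
  by move=> [a' [b' [h' [h'M ->]]]]; apply: Fitt_relation_norms.
have spanF : Fitt_ideals iota M (span I (relation_norms M)) by exists a, b, h.
rewrite /Fitt_max; case: xgetP => [J -> [JF Jmax]|/(_ (span I (relation_norms M)))].
  by apply/esym/Jmax => //; apply: sub.
case; split=> // J JF sJ; apply/seteqP; split=> //; exact: sub.
Qed.

End FittingIdeals.

(** * Quadratic presentations and short exact sequences *)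

Section FittingExact.
Variables (L : idomainType) (A : falgType {fraction L}) (sepA : separable_algebra A).
Variables (R : algType L) (iota : {rmorphism R -> A}) (ordR : is_order iota).
Hypothesis noethL : noetherian L.

Notation nrd := (@nrd L A R iota _).
Notation I := (nrd_ring iota).
Implicit Types M P : lmodType R.

Lemma nrd_lower_unipotent a b (V : 'M[R]_(b, a)) : nrd (block_mx 1%:M 0 V 1%:M) = 1.
Proof. by rewrite nrd_lblock // !nrd1 // mulr1. Qed.

(** In the joined generators all relations are combinations of the rows of one square matrix of norm
    [nrd h], and [H] extends to a relation matrix of unchanged norm; the quotient is [X]. *)
Lemma quadratic_relation_norms P a (h : 'M[R]_a) z :
  presents P h -> relation_norms iota P z -> exists2 x, I x & z = x * nrd h.
Proof.
move=> [p [p_onto ph]] [c [q [H [q_onto qH ->]]]].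
have [V [U [s [_ sh _ sH]]]] := join_generators p_onto q_onto ph.
have [X XE] : exists X, block_mx 1%:M (- U) 0 H = X *m block_mx h 0 (- V) 1%:M.
  by apply: kernel_rows_factor sh _ => i; rewrite rowE sH.
exists (nrd X); first exact: nrd_ring_nrd.
have := congr1 (fun Y => nrd Y) XE.
by rewrite nrd_ublock // nrdM // nrd_lblock // !nrd1 // mul1r mulr1.
Qed.

Lemma quadratic_Fitt P a (h : 'M[R]_a) z : presents P h ->
  span I (relation_norms iota P) z <-> exists2 x, I x & z = x * nrd h.
Proof.
have [I0 I1 ID IM] := nrd_ring_subring sepA iota.
move=> hP; split=> [|[x xI ->]]; last first.
  have [_ _ SM] := span_submodule I (relation_norms iota P); apply: SM => //.
  apply: span_gen; have [p [p_onto ph]] := hP.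
  exists a, p, h; split=> // i; apply/ph; exists (delta_mx 0 i); by rewrite rowE.
apply: (@span_min _ _ _ (fun z => exists2 x, I x & z = x * nrd h)).
  split; first by exists 0; rewrite ?mul0r.
    by move=> _ _ [x xI ->] [y yI ->]; exists (x + y); [exact: ID|rewrite mulrDl].
  by move=> c _ cI [x xI ->]; exists (c * x); [exact: IM|rewrite mulrA].
by move=> w; apply: quadratic_relation_norms.
Qed.

Section ShortExact.
Variables (M' M P : lmodType R) (f : {linear M' -> M}) (g : {linear M -> P}).
Hypothesis fg : short_exact f g.
Variables (a : nat) (h : 'M[R]_a) (pP : {linear 'rV[R]_a -> P}).
Hypotheses (pP_onto : onto pP) (pPh : kernel_rows pP h).

(** Generators of [P] are lifted to [M] and added to those of [M']. A relation of [P] lifts only to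
    an element of [f M'], and [U] records these elements for the rows of [h]. *)
Lemma horseshoe a' (p' : {linear 'rV[R]_a' -> M'}) : onto p' ->
  exists (s : {linear 'rV[R]_(a' + a) -> M}) (U : 'M[R]_(a, a')),
    [/\ onto s, forall u w, g (s (row_mx u w)) = pP w &
        forall u w, s (row_mx u (w *m h)) = f (p' (u + w *m U))].
Proof.
move=> p'_onto; have [f_inj fgE g_onto] := fg.
have [q qE] := lift_linear pP g_onto.
have [fp fpE] : exists fp : {linear 'rV[R]_a' -> M}, forall u, fp u = f (p' u) by exists (f \o p').
have [s sE] := linear_row_mx fp q.
have gf x : g (f x) = 0 by apply/fgE; exists x.
have [u uP] : {u : 'I_a -> 'rV[R]_a' & forall i, f (p' (u i)) = q (row i h)}.
  apply: (choice (P := fun i u => f (p' u) = q (row i h))) => i.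
  have [x <-] : exists x, f x = q (row i h).
    by apply/fgE; rewrite qE; apply/pPh; exists (delta_mx 0 i); rewrite rowE.
  by have [v <-] := p'_onto x; exists v.
exists s, (\matrix_i u i); split.
- move=> x; have [w we] := pP_onto (g x).
  have [x' x'E] : exists x', f x' = x - q w by apply/fgE; rewrite linearB /= qE we subrr.
  have [v vE] := p'_onto x'; exists (row_mx v w).
  by rewrite sE fpE vE x'E subrK.
- by move=> v w; rewrite sE fpE linearD /= gf add0r qE.
- move=> v w; rewrite sE fpE !linearD /=; congr (_ + _).
  rewrite mulmx_sum_row mulmx_sum_row !linear_sum; apply: eq_bigr => i _.
  by rewrite rowK !linearZ /= uP.
Qed.

Lemma relation_norms_sub z : relation_norms iota M' z -> relation_norms iota M (nrd h * z).
Proof.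
move=> [a' [p' [H [p'_onto pH ->]]]].
have [s [U [s_onto gs sh]]] := horseshoe p'_onto.
exists (a' + a)%N, s, (block_mx H 0 (- U) h); split=> // [i|]; last first.
  by rewrite nrd_lblock // nrd_center.
have key v : s (v *m block_mx H 0 (- U) h) = 0.
  rewrite -[v]hsubmxK mul_row_block mulmx0 add0r sh mulmxN subrK.
  by rewrite rows_mul // linear0.
by rewrite rowE key.
Qed.

(** [H] is padded to [N], of the same norm, so that the first [a' + a] entries of each row form a
    relation of the generators [s]. Its [P] part is a multiple of [h] and the correction by [U]
    leaves a relation of [M'], so [N] is a relation matrix of [M'] times [T], whose norm is
    [nrd h]. *)
Lemma relation_norms_quotient z : fin_gen_module M' ->
  relation_norms iota M z -> exists2 y, relation_norms iota M' y & z = nrd h * y.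
Proof.
move=> [a' [e eP]] [c [q [H [q_onto qH ->]]]].
have [p' p'E] := linear_rows e.
have p'_onto : onto p'.
  move=> x; have [k ->] := eP x; exists (\row_i k i); rewrite p'E.
  by apply: eq_bigr => i _; rewrite mxE.
have [f_inj fgE g_onto] := fg.
have [s [U [s_onto gs sh]]] := horseshoe p'_onto.
have [V VP] := lift_matrix q s_onto; have [U2 U2P] := lift_matrix s q_onto.
pose T := block_mx (block_mx 1%:M 0 (- U) h) 0 0 (1%:M : 'M[R]_c).
pose N := block_mx 1%:M (- U2) 0 H *m block_mx 1%:M 0 V 1%:M.
(* Generators equal to 0 are added to those of [M'], to make room for the coordinates [w] and [t],
   on which no condition is imposed. *)
have [p0 p0E] := linear_row_mx p' ((\0 : {linear 'rV[R]_a -> M'})%R).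
have [p1 p1E] := linear_row_mx p0 ((\0 : {linear 'rV[R]_c -> M'})%R).
have rowN i : exists x : 'rV[R]_(a' + a + c), p1 x = 0 /\ row i N = x *m T.
  have [v [t [vt st]]] : exists v t, row i N = row_mx v t /\ s v = 0.
    rewrite rowE /N mulmxA -[delta_mx 0 i]hsubmxK mul_row_block mulmx0 addr0 mulmx1.
    rewrite mul_row_block mulmx1 mulmx0 add0r mulmx1.
    eexists; eexists; split; first by [].
    rewrite linearD /= -VP linearD /= mulmxN linearN /= -U2P.
    by rewrite [q (_ *m H)]rows_mul // addr0 subrr.
  have /pPh [w wE] : pP (rsubmx v) = 0 by rewrite -(gs (lsubmx v)) hsubmxK st linear0.
  have pv : p' (lsubmx v + w *m U) = 0.
    by apply: f_inj; rewrite -sh -wE hsubmxK st linear0.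
  exists (row_mx (row_mx (lsubmx v + w *m U) w) t).
  rewrite p1E p0E pv /= !addr0; split=> //.
  rewrite vt mul_row_block !mulmx0 mulmx1 addr0 add0r mul_row_block mulmx1 mulmx0 add0r.
  by rewrite mulmxN addrK -wE hsubmxK.
have [x xP] : {x : 'I_(a' + a + c) -> 'rV[R]_(a' + a + c) & forall i, p1 (x i) = 0 /\ row i N = x i *m T}.
  exact: (choice (P := fun i x => p1 x = 0 /\ row i N = x *m T)).
pose G := \matrix_i x i.
have NG : N = G *m T.
  by apply/row_matrixP => i; rewrite [RHS]row_mul rowK; have [_] := xP i.
exists (nrd G).
  exists (a' + a + c)%N, p1, G; split=> // [y|i]; last by rewrite rowK; have [] := xP i.
  have [u <-] := p'_onto y; exists (row_mx (row_mx u 0) 0).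
  by rewrite p1E p0E !addr0.
have := congr1 (fun Y => nrd Y) NG.
rewrite /N !nrdM // nrd_ublock // nrd_lower_unipotent nrd_lblock // nrd_lblock // !nrd1 //.
by rewrite mul1r !mulr1 mul1r => ->; rewrite nrd_center.
Qed.

End ShortExact.

End FittingExact.

(** * Products of submodules and localization *)

Section SubmoduleProducts.
Variables (T : nzRingType) (C : set T).
Hypotheses (Csub : is_subring C) (Cctr : forall c, C c -> center c).
Implicit Types X Y Z : set T.

Lemma submodule_mul_submodule X Y : submodule C (submodule_mul C X Y).
Proof. exact: span_submodule. Qed.

Lemma submodule_mul_in X Y x y : X x -> Y y -> submodule_mul C X Y (x * y).
Proof. by move=> Xx Yy; apply: span_gen; exists x, y. Qed.

Lemma submodule_mulA X Y Z :
  submodule_mul C X (submodule_mul C Y Z) = submodule_mul C (submodule_mul C X Y) Z.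
Proof.
apply/seteqP; split.
  apply: span_min; first exact: span_submodule.
  move=> _ [x [w [Xx YZw ->]]]; move: w YZw.
  have [S0 SD SM] := submodule_mul_submodule (submodule_mul C X Y) Z.
  apply: (@span_min _ _ _ (fun w => submodule_mul C (submodule_mul C X Y) Z (x * w))).
    split; [by rewrite mulr0|by move=> w w' sw sw'; rewrite mulrDr; apply: SD|].
    by move=> c w Cc sw; rewrite mulrA -(Cctr Cc) -mulrA; apply: SM.
  move=> _ [y [z [Yy Zz ->]]]; rewrite mulrA.
  by apply: submodule_mul_in => //; apply: submodule_mul_in.
apply: span_min; first exact: span_submodule.
move=> _ [w [z [XYw Zz ->]]]; move: w XYw.
have [S0 SD SM] := submodule_mul_submodule X (submodule_mul C Y Z).
apply: (@span_min _ _ _ (fun w => submodule_mul C X (submodule_mul C Y Z) (w * z))).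
  split; [by rewrite mul0r|by move=> w w' sw sw'; rewrite mulrDl; apply: SD|].
  by move=> c w Cc sw; rewrite -mulrA; apply: SM.
move=> _ [x [y [Xx Yy ->]]]; rewrite -mulrA.
by apply: submodule_mul_in => //; apply: submodule_mul_in.
Qed.

Lemma submodule_mulC X Y : (forall x, X x -> center x) ->
  submodule_mul C X Y = submodule_mul C Y X.
Proof.
move=> Xctr; congr (span C _); apply/seteqP; split.
  by move=> _ [x [y [Xx Yy ->]]]; exists y, x; split=> //; apply: Xctr.
by move=> _ [y [x [Yy Xx ->]]]; exists x, y; split=> //; apply/esym/Xctr.
Qed.

Lemma submodule_mul1 X : submodule C X -> submodule_mul C C X = X.
Proof.
have [_ C1 _ _] := Csub; move=> Xsub; apply/seteqP; split.
  apply: span_min => // _ [c [x [Cc Xx ->]]].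
  by have [_ _ XM] := Xsub; apply: XM.
by move=> x Xx; rewrite -[x]mul1r; apply: submodule_mul_in.
Qed.

Lemma fin_gen_submodule X : fin_gen C X -> submodule C X.
Proof. by move=> [n [x ->]]; apply: span_submodule. Qed.

Lemma fin_gen_finType (J : finType) (x : J -> T) : fin_gen C (span C (range x)).
Proof.
exists #|J|, (x \o enum_val); congr (span C _); apply/seteqP; split.
  by move=> _ [j _ <-]; exists (enum_rank j); rewrite //= enum_rankK.
by move=> _ [j _ <-]; exists (enum_val j).
Qed.

Lemma fin_gen_mul X Y : (forall x, X x -> center x) ->
  fin_gen C X -> fin_gen C Y -> fin_gen C (submodule_mul C X Y).
Proof.
move=> Xctr [n [x XE]] [m [y YE]].
suff -> : submodule_mul C X Y = span C (range (fun ij : 'I_n * 'I_m => x ij.1 * y ij.2)).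
  exact: fin_gen_finType.
have [S0 SD SM] := span_submodule C (range (fun ij : 'I_n * 'I_m => x ij.1 * y ij.2)).
apply/seteqP; split.
  apply: span_min; first exact: span_submodule.
  move=> _ [u [v [Xu Yv ->]]]; rewrite XE in Xu; move: u Xu.
  apply: (@span_min _ _ _ (fun u => span C (range (fun ij : 'I_n * 'I_m => x ij.1 * y ij.2)) (u * v))).
    split; [by rewrite mul0r|by move=> w w' sw sw'; rewrite mulrDl; apply: SD|].
    by move=> c w Cc sw; rewrite -mulrA; apply: SM.
  move=> _ [i _ <-]; rewrite YE in Yv; move: v Yv.
  apply: (@span_min _ _ _ (fun v => span C (range (fun ij : 'I_n * 'I_m => x ij.1 * y ij.2)) (x i * v))).
    split; [by rewrite mulr0|by move=> w w' sw sw'; rewrite mulrDr; apply: SD|].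
    by move=> c w Cc sw; rewrite mulrA -(Cctr Cc) -mulrA; apply: SM.
  by move=> _ [j _ <-]; apply: span_gen; exists (i, j).
apply: span_mono => _ [[i j] _ <-]; exists (x i), (y j); split=> //.
  by rewrite XE; apply: span_gen; exists i.
by rewrite YE; apply: span_gen; exists j.
Qed.

End SubmoduleProducts.

Section Localization.
Variables (L : idomainType) (A : falgType {fraction L}) (sepA : separable_algebra A).
Variables (R : algType L) (iota : {rmorphism R -> A}) (ordR : is_order iota).
Variables (S : set L) (S_1 : S 1) (S_mul : forall s t : L, S s -> S t -> S (s * t)).
Hypothesis S_0 : ~ S 0.

Notation nrd := (@nrd L A R iota _).
Notation I := (nrd_ring iota).
Notation loc := (nrd_ring_loc iota S).

Definition nrd_scalar (s : L) : A := nrd (const_mx s%:A : 'M[R]_1).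

Lemma nrd_scalar_center s : center (nrd_scalar s).
Proof. exact: nrd_center. Qed.

Lemma nrd_scalarM s t : nrd_scalar (s * t) = nrd_scalar s * nrd_scalar t.
Proof.
rewrite /nrd_scalar -nrdM //; congr nrd; apply/matrixP => i j.
by rewrite !mxE big_ord1 !mxE -scalerAl mul1r scalerA.
Qed.

Lemma nrd_scalar1 : nrd_scalar 1 = 1.
Proof.
rewrite /nrd_scalar -[RHS](nrd1 sepA iota 1); congr nrd; apply/matrixP => i j.
by rewrite !mxE !ord1 scale1r.
Qed.

(** The reduced norm is defined on all of [A], so the inverse of [s] there has a norm too. *)
Lemma nrd_scalar_unit s : S s -> nrd_scalar s \is a GRing.unit.
Proof.
move=> Ss; have s0 : s != 0 by apply/eqP => s0; rewrite s0 in Ss.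
have [_ iotaZ _ _] := ordR.
pose w := Nrd (const_mx ((tofrac s)^-1 *: 1) : 'M[A]_1).
have sw : nrd_scalar s * w = 1.
  rewrite /nrd_scalar /Defs.nrd -NrdM // -[RHS](Nrd1 sepA 1); congr Nrd.
  apply/matrixP => i j; rewrite !mxE big_ord1 !mxE !ord1 iotaZ rmorph1.
  by rewrite -scalerAl mul1r scalerA divff ?scale1r // tofrac_eq0.
by apply/unitrP; exists w; split=> //; rewrite -nrd_scalar_center.
Qed.

Lemma center_inv (u : A) : center u -> center u^-1.
Proof. by move=> uC y; apply/esym/commrV/esym/uC. Qed.

Lemma loc_center z : loc z -> center z.
Proof.
move=> [x [s [xI Ss ->]]]; apply: centerM; first exact: nrd_ring_center xI.
exact/center_inv/nrd_scalar_center.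
Qed.

Lemma nrd_ring_sub_loc : I `<=` loc.
Proof.
move=> x xI; exists x, 1; split=> //.
by rewrite -/(nrd_scalar 1) nrd_scalar1 invr1 mulr1.
Qed.

Lemma locM x y : loc x -> loc y -> loc (x * y).
Proof.
move=> [x' [s [x'I Ss ->]]] [y' [t [y'I St ->]]]; exists (x' * y'), (s * t).
have [_ _ _ IM] := nrd_ring_subring sepA iota.
split; [exact: IM|exact: S_mul|].
rewrite -!/(nrd_scalar _) nrd_scalarM invrM ?nrd_scalar_unit //.
have cs := center_inv (nrd_scalar_center s).
rewrite -(cs (nrd_scalar t)^-1) !mulrA; congr (_ * _).
by rewrite -!mulrA; congr (_ * _); apply: cs.
Qed.

Lemma loc_submodule : submodule I loc.
Proof.
have [I0 I1 ID IM] := nrd_ring_subring sepA iota; split.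
- exact/nrd_ring_sub_loc.
- move=> _ _ [x [s [xI Ss ->]]] [y [t [yI St ->]]].
  exists (x * nrd_scalar t + y * nrd_scalar s), (s * t).
  split; [|exact: S_mul|].
    by apply: ID; apply: IM => //; apply: nrd_ring_nrd.
  rewrite -!/(nrd_scalar _) nrd_scalarM mulrDl invrM ?nrd_scalar_unit //.
  rewrite !mulrA mulrK ?nrd_scalar_unit //; congr (_ + _).
  rewrite -!mulrA; congr (_ * _).
  rewrite (center_inv (nrd_scalar_center t)) mulrA mulrV ?nrd_scalar_unit //.
  by rewrite mul1r.
- by move=> c x cI xl; apply: locM => //; apply: nrd_ring_sub_loc.
Qed.

(** [t] is [s^a], so this norm is an admissible denominator of the localization. *)
Lemma nrd_scalar_mx a (s : L) : exists2 t, nrd ((s%:A : R)%:M : 'M_a) = nrd_scalar t & S s -> S t.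
Proof.
elim: a => [|a [t tE St]].
  exists 1; rewrite ?nrd_scalar1 //.
  rewrite -[RHS](nrd1 sepA iota 0); congr nrd; by rewrite [LHS]flatmx0 [RHS]flatmx0.
exists (s * t); last by move=> Ss; apply: S_mul => //; apply: St.
rewrite nrd_scalarM -tE -[a.+1]/(1 + a)%N scalar_mx_block nrd_lblock //.
congr (nrd _ * _); apply/matrixP => i j; by rewrite !mxE !ord1 mulr1n.
Qed.

End Localization.

(** * The Fitting invariant *)

Section FittingInvariant.
Variables (L : idomainType) (noethL : noetherian L).
Variables (A : falgType {fraction L}) (sepA : separable_algebra A).
Variables (R : algType L) (iota : {rmorphism R -> A}) (ordR : is_order iota).
Variables (S : set L) (S_1 : S 1) (S_mul : forall s t : L, S s -> S t -> S (s * t)).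
Hypothesis S_0 : ~ S 0.

Notation nrd := (@nrd L A R iota _).
Notation I := (nrd_ring iota).
Notation loc := (nrd_ring_loc iota S).

Lemma fin_gen_Fitt a b (h : 'M[R]_(b, a)) : fin_gen I (Fitt iota h).
Proof.
(* The value 0 for the other maps gives a finite index type without enlarging the span. *)
pose x (f : {ffun 'I_a -> 'I_b}) :=
  if `[< forall i j : 'I_a, (i < j)%N -> (f i < f j)%N >] then nrd (rowsub f h) else 0.
suff -> : Fitt iota h = span I (range x) by apply: fin_gen_finType.
have [S0 _ _] := span_submodule I (range x); have [F0 _ _] := Fitt_submodule iota h.
apply/seteqP; split; apply: span_min; try exact: span_submodule.
  move=> _ [f f_incr ->]; apply: span_gen; exists (finfun f) => //.
  rewrite /x; case: asboolP => [_|[]].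
    by congr nrd; apply/matrixP => i j; rewrite !mxE ffunE.
  by move=> i j; rewrite !ffunE; apply: f_incr.
move=> _ [f _ <-]; rewrite /x; case: asboolP => // f_incr.
by apply: span_gen; exists f.
Qed.

(** The product [s] of annihilators of the generators kills [P], so [s] times the identity is a
    relation matrix and factors as [X *m h]; now take norms. *)
Lemma torsion_quadratic_unit P a (h : 'M[R]_a) : catM S P -> presents P h ->
  exists2 y, loc y & y * nrd h = 1.
Proof.
move=> [[n [e eP]] tors] [p [p_onto ph]].
have [s Ss sP] : exists2 s, S s & forall u, p ((s%:A : R) *: u) = 0.
  have [s sE] : exists s : 'I_a -> L, forall i, S (s i) /\ (s i)%:A *: p (delta_mx 0 i) = 0.
    suff [s sE] : {s : 'I_a -> L & forall i, S (s i) /\ ((s i)%:A : R) *: p (delta_mx 0 i) = 0} by exists s.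
    apply: (choice (P := fun i s => S s /\ (s%:A : R) *: p (delta_mx 0 i) = 0)) => i.
    by have [s] := tors (p (delta_mx 0 i)); exists s.
  exists (\prod_i s i); first by elim/big_ind: _ => // i _; have [] := sE i.
  move=> u; rewrite linear_delta big1 // => i _.
  rewrite mxE (bigD1 i) //= -[_%:A * _]/(_ * _); have [_ se] := sE i.
  set q := \prod_(_ < _ | _) _.
  have -> : ((s i * q)%:A : R) * u 0 i = (q *: u 0 i) * (s i)%:A.
    by rewrite mulr_algl -scalerAr mulr1 scalerA.
  by rewrite -scalerA se scaler0.
have [X XE] : exists X, (s%:A : R)%:M = X *m h.
  by apply: kernel_rows_factor ph _ => i; rewrite -scalemx1 linearZ /= row1 sP.
have [t tE St] := nrd_scalar_mx sepA iota S_1 S_mul a s.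
have Xh : nrd X * nrd h = nrd_scalar iota t by rewrite -nrdM // -XE.
exists (nrd X / nrd_scalar iota t).
  by exists (nrd X), t; split=> //; [exact: nrd_ring_nrd|exact: St].
rewrite -mulrA (center_inv (nrd_scalar_center sepA iota t)) mulrA Xh.
by rewrite mulrV // (nrd_scalar_unit sepA ordR S_0) //; exact: St.
Qed.

Notation F := (fun M : lmodType R => Fitt_max iota M).

Lemma Omega_monoid : comm_monoid (Omega iota S) (submodule_mul I) I.
Proof.
have Isub := nrd_ring_subring sepA iota.
have Ictr : forall c, I c -> center c := nrd_ring_center sepA ordR.
have ctr X : Omega iota S X -> forall x, X x -> center x.
  by move=> [Xl _] x /Xl; apply: loc_center.
split.
- split; first exact: nrd_ring_sub_loc.
  have [I0 I1 _ _] := Isub; rewrite -{2}(span_id (submodule_nrd_ring sepA iota)).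
  suff -> : span I I = span I (range (fun _ : 'I_1 => 1)) by exists 1%N, (fun=> 1).
  apply/seteqP; split.
    apply: span_min => [|x xI]; first exact: span_submodule.
    apply/span_finP => //; exists (fun=> x); split=> //.
    by rewrite big_ord1 mulr1.
  by apply: span_mono => _ [_ _ <-].
- move=> X Y XO YO; split; last first.
    by apply: fin_gen_mul => //; [exact: ctr XO|case: XO|case: YO].
  apply: span_min; first exact: loc_submodule.
  move=> _ [x [y [Xx Yy ->]]].
  by apply: locM => //; [case: XO => /(_ _ Xx)|case: YO => /(_ _ Yy)].
- by move=> X Y Z _ _ _; apply: submodule_mulA.
- by move=> X Y XO _; apply: submodule_mulC; apply: ctr XO.
- by move=> X [_ /fin_gen_submodule XI]; apply: submodule_mul1.
Qed.

Lemma Fitt_max_Omega M : fin_gen_module M -> Omega iota S (Fitt_max iota M).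
Proof.
move=> Mfg; rewrite Fitt_maxE //; split; last first.
  have [a [b [h [_ <-]]]] := Fitt_relation_norms_eq sepA ordR noethL Mfg.
  exact: fin_gen_Fitt.
move=> z zJ; apply: (nrd_ring_sub_loc sepA S_1); move: z zJ.
by apply: span_min; [exact: submodule_nrd_ring|exact: relation_norms_nrd_ring].
Qed.

Lemma Fitt_max_unit P : catM S P -> quadratic_presentation P ->
  exists2 Y, Omega iota S Y & submodule_mul I (Fitt_max iota P) Y = I.
Proof.
move=> Pcat [a [h hP]]; have [y yl yh] := torsion_quadratic_unit Pcat hP.
have Isub := nrd_ring_subring sepA iota; have [I0 I1 ID IM] := Isub.
have FPE := quadratic_Fitt sepA iota _ hP.
(* The maximal Fitting ideal of [P] is generated by [nrd h], so its inverse is generated by [y]. *)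
exists (span I (range (fun _ : 'I_1 => y))).
  split; last by exists 1%N, (fun=> y).
  apply: span_min => [|_ [_ _ <-] //]; exact: loc_submodule.
rewrite Fitt_maxE //; last by case: Pcat.
apply/seteqP; split.
  apply: span_min; first exact: submodule_nrd_ring.
  move=> _ [x [z [/FPE [i iI ->] /span_finP [//|c [cI ->]] ->]]].
  by rewrite big_ord1 -mulrA nrd_center // -(mulrA (c _)) yh mulr1; apply: IM.
move=> x xI; rewrite -[x]mulr1 -yh (loc_center sepA ordR yl) mulrA.
apply: submodule_mul_in; first by apply/FPE; exists x.
by apply: span_gen; exists ord0.
Qed.

Lemma Fitt_max_exact (M' M P : lmodType R) (f : {linear M' -> M}) (g : {linear M -> P}) :
  fin_gen_module M' -> fin_gen_module M -> fin_gen_module P ->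
  quadratic_presentation P -> short_exact f g ->
  Fitt_max iota M = submodule_mul I (Fitt_max iota P) (Fitt_max iota M').
Proof.
move=> M'fg Mfg Pfg [a [h hP]] fg; have [p [p_onto ph]] := hP.
have [I0 I1 ID IM] := nrd_ring_subring sepA iota.
have Ictr : forall c, I c -> center c := nrd_ring_center sepA ordR.
have FPE := quadratic_Fitt sepA iota _ hP.
rewrite !Fitt_maxE //; apply/seteqP; split.
  apply: span_min; first exact: span_submodule.
  move=> z /(relation_norms_quotient sepA fg p_onto ph M'fg) [y yM' ->].
  apply: submodule_mul_in; first by apply/FPE; exists 1; rewrite ?mul1r.
  exact: span_gen.
apply: span_min; first exact: span_submodule.
move=> _ [x [y [/FPE [i iI ->] yM' ->]]].
have [S0 SD SM] := span_submodule I (relation_norms iota M).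
rewrite -mulrA; apply: (SM) => //; move: y yM'.
apply: (@span_min _ _ _ (fun y => span I (relation_norms iota M) (nrd h * y))).
  split; [by rewrite mulr0|by move=> u v su sv; rewrite mulrDr; apply: SD|].
  by move=> c u cI su; rewrite mulrA -(Ictr _ cI) -mulrA; apply: SM.
move=> y yM'; apply: span_gen.
exact: (relation_norms_sub sepA fg p_onto ph).
Qed.

End FittingInvariant.

Theorem proposition2p11
  (L : idomainType)
  (noethL : noetherian L) (clocL : complete_local L)
  (A : falgType {fraction L}) (sepA : separable_algebra A)
  (R : algType L) (iota : {rmorphism R -> A}) (ordR : is_order iota)
  (S : set L) (S_1 : S 1) (S_mul : forall s t : L, S s -> S t -> S (s * t))
  (S_0 : ~ S 0)
  (quad : forall P : lmodType R, catP S P -> quadratic_presentation P) :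
  fitting_invariant S (Omega iota S)
    (submodule_mul (nrd_ring iota)) (nrd_ring iota)
    (fun M : lmodType R => Fitt_max iota M).
Proof.
split.
- exact: Omega_monoid.
- by move=> M [Mfg _]; apply: Fitt_max_Omega.
- by move=> P PP; have [Pcat _] := PP; apply: Fitt_max_unit (quad P PP).
- move=> M' M P f g [M'fg _] [Mfg _] PP; have [[Pfg _] _] := PP.
  exact: Fitt_max_exact (quad P PP).
Qed.
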